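(* Let $\mathfrak{X}=(c_0,p)$ be the Banach space constructed from the data $(\vert\vert\vert\cdot\vert\vert\vert, Y, T)$ as described in the context, and let $M$ be a closed subspace of $\mathfrak{X}$ of codimension two, with quotient map $\pi_M:\mathfrak{X}\to\mathfrak{X}/M$. Then: (a) The set $\{x\in B_{\mathfrak{X}} : \pi_M(x)\in S_{\mathfrak{X}/M}\}$ contains, at most, two distinct elements and their opposites. (b) There are two elements $x_1,x_2\in B_{\mathfrak{X}}$ such that $\pi_M(B_{\mathfrak{X}})\cap S_{\mathfrak{X}/M}\subseteq\{x_1+M,\,x_2+M,\,-x_1+M,\,-x_2+M\}$. (c) There are two elements $x_1,x_2\in\mathfrak{X}$ such that the (maybe empty) set of elements of $\mathfrak{X}/M$ given by $\{x+M : x\in\mathfrak{X}\setminus M,\ P_M(x)\neq\emptyset\}$ is contained in $\mathbb{R}(x_1+M)\cup\mathbb{R}(x_2+M)$.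
   Context: All Banach spaces are real; $\mathbb{N}=\{1,2,\dots\}$; operators are bounded and linear. $B_X$, $S_X$ are the closed unit ball and unit sphere of $X$; $X^*$ is the dual with the dual norm. $\mathfrak{X}/M$ carries the quotient norm. For a closed subspace $M$ of $X$ and $x\in X\setminus M$, $P_M(x)=\{m\in M : \|x-m\|=\operatorname{dist}(x,M)\}$. $\operatorname{NA}(X,\mathbb{R})$ is the set of $f\in X^*$ for which there is $x\in S_X$ with $|f(x)|=\|f\|$. A norm is smooth if it is Gâteaux differentiable at every non-zero point (equivalently, every non-zero point has a unique norm-one supporting functional). A linear subspace $Y$ of a Banach space $V$ is an operator range if there are an infinite-dimensional Banach space $E$ and a bounded injective operator $E\to V$ with range $Y$; $Y$ carries the norm inherited from $V$, and $S_Y$ is its unit sphere for that norm. Construction of $\mathfrak{X}$. (1) Let $X=c_0$ be endowed with an equivalent smooth norm $\vert\vert\vert\cdot\vert\vert\vert$ such that $\operatorname{NA}((X,\vert\vert\vert\cdot\vert\vert\vert),\mathbb{R})=\operatorname{NA}(c_0,\mathbb{R})$, where $c_0$ has its usual supremum norm. The dual norm on $X^*$ is also written $\vert\vert\vert\cdot\vert\vert\vert$. Let $Y$ be a separable operator range, norm dense in $(X,\vert\vert\vert\cdot\vert\vert\vert)^*$, with $\operatorname{NA}((X,\vert\vert\vert\cdot\vert\vert\vert),\mathbb{R})\cap Y=\{0\}$. (2) Let $T:\ell_1(\mathbb{N}\times\mathbb{N})\to Y\subset (X,\vert\vert\vert\cdot\vert\vert\vert)^*$ be a norm-one injective operator such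 that, for every $m\in\mathbb{N}$, the set $\{T(e_{n,m})/\vert\vert\vert T(e_{n,m})\vert\vert\vert : n\in\mathbb{N}\}$ is dense in $S_Y$, where $(e_{n,m})$ is the canonical basis of $\ell_1(\mathbb{N}\times\mathbb{N})$. Put $v^*_{n,m}=T(e_{n,m})$. (Such $\vert\vert\vert\cdot\vert\vert\vert$, $Y$, $T$ exist; they are fixed.) (3) For $m\in\mathbb{N}$, let $\Phi_m(n)=\frac{1}{2^m}\frac{1}{2^n}\vert\vert\vert v^*_{n,m}\vert\vert\vert$ $(n\in\mathbb{N})$, let $S_{\Phi_m}:\ell_2\to\ell_1$ be given by $[S_{\Phi_m}(a)](n)=\Phi_m(n)a(n)$, and let $|\cdot|_m$ be the equivalent norm on $\ell_1$ whose closed unit ball is $B_{\ell_1}+S_{\Phi_m}(B_{\ell_2})$. (4) For $m\in\mathbb{N}$, define $R_m:X\to \ell_1$ by $[R_m(x)](n)=\frac{m}{2^m}\frac{1}{2^n}v^*_{n,m}(x)$ for $n\in\mathbb{N}$, $x\in X$. (5) Define the equivalent norm $p$ on $X=c_0$ by $p(x)=\vert\vert\vert x\vert\vert\vert+\sum_{m=1}^\infty |R_m(x)|_m$ for $x\in X$, and set $\mathfrak{X}=(X,p)$. *)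

(* Defs.v *)
From HB Require Import structures.
From mathcomp Require Import all_boot all_order all_algebra.
From mathcomp Require Import all_classical all_reals all_analysis.

Set Implicit Arguments.
Unset Strict Implicit.
Unset Printing Implicit Defensive.

Import Order.TTheory GRing.Theory Num.Theory.
Import numFieldNormedType.Exports.

Local Open Scope classical_set_scope.
Local Open Scope ring_scope.

(* Several norms live on the same vector space, so a normed space is given by
   an lmodType V together with a function N : V -> R, and every metric notion
   below takes N as a parameter. *)

Section NormedSpaces.
Context {R : realType}.
Implicit Types V W : lmodType R.

Definition is_norm V (N : V -> R) : Prop :=
  [/\ forall x y, N (x + y) <= N x + N y,
      forall (a : R) x, N (a *: x) = `|a| * N x
    & forall x, N x = 0 -> x = 0].

Definition equivalent_norms V (N1 N2 : V -> R) : Prop :=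
  exists c C : R,
    [/\ 0 < c, 0 < C & forall x, c * N1 x <= N2 x /\ N2 x <= C * N1 x].

Definition nball V (N : V -> R) : set V := [set x | N x <= 1].

Definition nsphere V (N : V -> R) : set V := [set x | N x = 1].

Definition is_bounded V W (NV : V -> R) (NW : W -> R) (f : V -> W) : Prop :=
  exists C : R, forall x, NW (f x) <= C * NV x.

(* [sup] is 0 on unbounded sets: [opnorm] is meant for bounded operators. *)
Definition opnorm V W (NV : V -> R) (NW : W -> R) (f : V -> W) : R :=
  sup [set NW (f x) | x in nball NV].

Definition dense_in V (N : V -> R) (D A : set V) : Prop :=
  D `<=` A /\ forall a, A a -> forall e : R, 0 < e -> exists2 d, D d & N (a - d) < e.

Definition separable V (N : V -> R) (A : set V) : Prop :=
  exists2 D : set V, countable D & dense_in N D A.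

Definition linear_subspace V (M : set V) : Prop :=
  M 0 /\ forall (a : R) x y, M x -> M y -> M (a *: x + y).

Definition nclosed V (N : V -> R) (M : set V) : Prop :=
  forall x, (forall e : R, 0 < e -> exists2 m, M m & N (x - m) < e) -> M x.

(* The classes of e_0, ..., e_(n-1) form a basis of V / M. *)
Definition codimension V (M : set V) (n : nat) : Prop :=
  exists e : 'I_n -> V, forall x : V,
    exists! a : {ffun 'I_n -> R}, M (x - \sum_i a i *: e i).

Definition infinite_dimensional V : Prop :=
  forall (n : nat) (e : 'I_n -> V),
    ~ (forall x : V, exists a : 'I_n -> R, x = \sum_i a i *: e i).

Definition operator_range V (N : V -> R) (Y : set V) : Prop :=
  exists (E : completeNormedModType R) (j : {linear E -> V}),
    [/\ infinite_dimensional E, is_bounded (@Num.norm R E) N j,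
        injective j & range j = Y].

(* The Minkowski functional of A; when A is the closed unit ball of a norm,
   it is that norm. *)
Definition minkowski_gauge V (A : set V) (x : V) : R :=
  inf [set t : R | 0 < t /\ exists2 a, A a & x = t *: a].

End NormedSpaces.

Section Dual.
Context {R : realType} {V : lmodType R}.
Variable N : V -> R.

Definition dual_pred : {pred V -> R^o} :=
  fun f => `[< linear f /\ is_bounded N (@Num.norm R R) f >].

Lemma dual_pred_submod : submod_closed dual_pred.
Proof.
split.
  apply/asboolP; split; first by move=> a x y /=; rewrite scaler0 addr0.
  by exists 0 => x; rewrite normr0 mul0r.
move=> a f g /asboolP[lf [C hC]] /asboolP[lg [D hD]]; apply/asboolP; split.
  move=> b x y /=; rewrite !fctE /= lf lg !scalerDr !scalerA (mulrC b a).
  by rewrite -!addrA; congr (_ + _); rewrite addrCA.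
exists (`|a| * C + D) => x; rewrite !fctE mulrDl.
apply: (le_trans (ler_normD _ _)); apply: lerD; last exact: hD.
by rewrite normrM -mulrA ler_wpM2l.
Qed.

HB.instance Definition _ := GRing.isSubmodClosed.Build R _ dual_pred dual_pred_submod.

Record dual := Dual { dual_fun :> V -> R^o ; _ : dual_fun \in dual_pred }.

HB.instance Definition _ := [isSub for dual_fun].
HB.instance Definition _ := [Choice of dual by <:].
HB.instance Definition _ := [SubChoice_isSubLmodule of dual by <:].

Definition dual_norm (f : dual) : R := opnorm N (@Num.norm R R) f.

Definition NA : set dual :=
  [set f : dual | exists2 x, nsphere N x & `|f x| = dual_norm f].

(* Gateaux differentiability of N off the origin. *)
Definition smooth_norm : Prop :=
  forall x : V, x != 0 -> exists f : dual, forall h : V,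
    t^-1 * (N (x + t *: h) - N x) @[t --> 0^'] --> (f h : R).

End Dual.
Arguments NA {R V} N.
Arguments dual_norm {R V} N f.

Section Quotient.
Context {R : realType} {V : lmodType R}.
Variables (N : V -> R) (M : set V).

(* Elements of V / M are the cosets x + M, as subsets of V; [coset] is the
   quotient map. *)
Definition coset (x : V) : set V := [set x + m | m in M].

Definition quotient_norm (A : set V) : R := inf [set N y | y in A].

Definition quotient_sphere : set (set V) :=
  [set A | range coset A /\ quotient_norm A = 1].

(* The line R (x + M) of V / M; note that a (x + M) is a x + M. *)
Definition quotient_line (x : V) : set (set V) :=
  [set coset (a *: x) | a in [set: R]].

Definition dist (x : V) : R := inf [set N (x - m) | m in M].

Definition metric_projection (x : V) : set V :=
  [set m | M m /\ N (x - m) = dist x].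

End Quotient.

Section SequenceSpaces.
Variable R : realType.

Definition c0_pred : {pred nat -> R^o} :=
  fun x => `[< (x n : R) @[n --> \oo] --> (0 : R) >].

Lemma c0_pred_submod : submod_closed c0_pred.
Proof.
split; first by apply/asboolP; exact: cvg_cst.
move=> a f g /asboolP cf /asboolP cg; apply/asboolP.
rewrite -[X in _ --> X]addr0 -[X in _ --> X + _](mulr0 a).
apply: cvgD => //; exact: cvgMr.
Qed.

HB.instance Definition _ := GRing.isSubmodClosed.Build R _ c0_pred c0_pred_submod.

Record c0 := C0 { c0_seq :> nat -> R^o ; _ : c0_seq \in c0_pred }.

HB.instance Definition _ := [isSub for c0_seq].
HB.instance Definition _ := [Choice of c0 by <:].
HB.instance Definition _ := [SubChoice_isSubLmodule of c0 by <:].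

Definition supnorm (x : c0) : R := sup [set `|x n| | n in [set: nat]].

Section l1.
Variable I : choiceType.

Definition l1_pred : {pred I -> R^o} :=
  fun a => `[< summable [set: I] (fun i => (a i : R)%:E) >].

Lemma l1_pred_submod : submod_closed l1_pred.
Proof.
split.
  apply/asboolP; rewrite /summable esum1 // => i _.
  by rewrite /= normr0.
move=> a f g /asboolP sf /asboolP sg; apply/asboolP.
have sZ (n : nat) : summable [set: I] (fun i => (f i *+ n : R)%:E).
  elim: n => [|n IHn].
    by rewrite /summable esum1 // => i _; rewrite /= mulr0n normr0.
  apply: le_lt_trans (lte_add_pinfty sf IHn).
  rewrite -esumD; [|by move=> *; exact: abse_ge0..].
  by apply: le_esum => i _; rewrite mulrS EFinD lee_abs_add.
apply: (summableD (f := fun i => (a * f i)%:E)) sg.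
apply: le_lt_trans (sZ (Num.truncn `|a|).+1).
apply: le_esum => i _; rewrite lee_fin normrM normrMn -mulr_natl.
by apply: ler_wpM2r => //; rewrite ltW // truncnS_gt.
Qed.

HB.instance Definition _ := GRing.isSubmodClosed.Build R _ l1_pred l1_pred_submod.

Record l1 := L1 { l1_fun :> I -> R^o ; _ : l1_fun \in l1_pred }.

HB.instance Definition _ := [isSub for l1_fun].
HB.instance Definition _ := [Choice of l1 by <:].
HB.instance Definition _ := [SubChoice_isSubLmodule of l1 by <:].

Definition l1norm (a : l1) : R := fine (\esum_(i in [set: I]) `|(a i : R)%:E|)%E.

Definition kronecker (i : I) : I -> R^o := fun k => (k == i)%:R.

Lemma delta_l1 (i : I) : kronecker i \in l1_pred.
Proof.
apply/asboolP; rewrite /summable (esumID [set i]) // !setTI.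
rewrite esum_set1 // esum1 ?adde0 ?ltry // => k /eqP/negPf ki.
by rewrite /kronecker ki /= normr0.
Qed.

Definition l1_basis (i : I) : l1 := L1 (delta_l1 i).

End l1.

Definition l2norm (a : nat -> R) : R :=
  Num.sqrt (fine (\esum_(i in [set: nat]) (a i ^+ 2)%:E)%E).

(* The summability clause is needed since [l2norm] is 0 on divergent sums. *)
Definition l2ball : set (nat -> R^o) :=
  [set a : nat -> R^o |
    summable [set: nat] (fun i => (a i ^+ 2 : R)%:E) /\ l2norm a <= 1].

Definition diag_op (Phi : nat -> R) (a : nat -> R^o) : nat -> R^o :=
  fun n => Phi n * a n.

(* The norm on l_1 whose closed unit ball is B_{l_1} + S_Phi(B_{l_2}), as a
   gauge on all sequences; it is only ever evaluated at elements of l_1. *)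
Definition gauge_norm (Phi : nat -> R) : (nat -> R^o) -> R :=
  minkowski_gauge [set l1_fun b + diag_op Phi a | b in nball (@l1norm nat) & a in l2ball].

End SequenceSpaces.

(* In the mathematical notation v*_{n,m}, Phi_m and R_m are indexed by
   n, m = 1, 2, ...; here n and m start at 0, hence the successors. *)
Section Renorming.
Context {R : realType}.
Variables (N : c0 R -> R) (T : l1 R (nat * nat)%type -> dual N).

Definition vstar (n m : nat) : dual N := T (l1_basis R (n, m)).

Definition Phi (m n : nat) : R :=
  (2 ^+ m.+1)^-1 * (2 ^+ n.+1)^-1 * dual_norm N (vstar n m).

(* R_m x lies in l_1 because T is bounded. *)
Definition R_op (m : nat) (x : c0 R) : nat -> R^o :=
  fun n => m.+1%:R / 2 ^+ m.+1 * (2 ^+ n.+1)^-1 * vstar n m x.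

(* A convergent series when T is bounded. *)
Definition p_norm (x : c0 R) : R :=
  N x + limn (series (fun m => gauge_norm (Phi m) (R_op m x))).

End Renorming.

(* Main.v *)
(** Let A be the set of norm-one points x whose coset x + M has quotient norm
    one.  At x <> 0 the norm p is Gateaux differentiable, with gradient
    F = f + T a where f, the gradient of |||.|||, attains its norm and
    a (n, m) = (m / 2^m) 2^-n g_m(n), g_m being the gradient of |.|_m at R_m x.
    If x is in A, then F vanishes on M.

    Three points x_i of A give three functionals on a two-dimensional space,
    so sum_i al_i F_i = 0 for some al <> 0.  Norm-attaining functionals on c_0
    are the finitely supported ones, hence a linear space, and
    sum_i al_i f_i = - T (sum_i al_i a_i) lies in NA and in Y: both sides are 0,
    and sum_i al_i g_{i,m}(n) = 0 for all n and m.  Now g_m(n) is the sign of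
    v*_{n,m}(x) up to an error 2^-m as soon as |v*_{n,m}(x)| / |||v*_{n,m}||| is
    not too small.  Since the directions of the v*_{n,m}, n in N, are dense for each m,
    sum_i al_i sg (y x_i) = 0 for every functional y not vanishing at any x_i.
    If no two of the x_i are proportional, there are functionals y whose signs
    differ at one x_i only, which forces al = 0.  So two of any three points of
    A are equal up to sign.

    The gradient of |.|_m at z is explicit: if z / t = u + Phi b is the optimal
    decomposition, then t b is z / Phi clipped at height lam Phi, where lam is
    such that t u and t b have the same norm t. *)
Require Import Defs.
From mathcomp Require Import all_boot all_order all_algebra.
From mathcomp Require Import all_classical all_reals all_analysis.
From mathcomp Require Import ring lra.

Set Implicit Arguments.
Unset Strict Implicit.
Unset Printing Implicit Defensive.

Import Order.TTheory GRing.Theory Num.Theory.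
Import numFieldNormedType.Exports.
Local Open Scope classical_set_scope.
Local Open Scope ring_scope.

(** * Sequence norms as bounds on partial sums *)

Lemma esum_le_of_seq (R : realType) (I : choiceType) (f : I -> R) (r : R) :
  (forall s : seq I, uniq s -> \sum_(i <- s) f i <= r) ->
  (\esum_(i in [set: I]) (f i)%:E <= r%:E)%E.
Proof.
move=> hs; apply: ge_ereal_sup => _ [A [finA _] <-].
by rewrite fsbig_finite //= sumEFin lee_fin; apply: hs.
Qed.

Lemma esum_ge_of_seq (R : realType) (I : choiceType) (f : I -> R) (s : seq I) :
  uniq s -> ((\sum_(i <- s) f i)%:E <= \esum_(i in [set: I]) (f i)%:E)%E.
Proof.
move=> us; apply: esum_ge; exists [set` s]; first by split=> //; exact: finite_seq.
by rewrite -fsbig_seq // sumEFin.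
Qed.

Section L1Norm.
Context {R : realType} {I : choiceType}.

Lemma l1normE (b : l1 R I) :
  (\esum_(i in [set: I]) `|b i|%:E)%E = (l1norm b)%:E.
Proof.
case: b => f sf; rewrite /l1norm /= fineK //.
by move: sf => /asboolP; rewrite summableE.
Qed.

Lemma sum_l1norm (b : l1 R I) (s : seq I) :
  uniq s -> \sum_(i <- s) `|b i| <= l1norm b.
Proof. by move=> us; rewrite -lee_fin -l1normE; exact: esum_ge_of_seq. Qed.

(** Elements of [l1] are later produced from bounds on finite partial sums alone. *)
Lemma l1_ofP (f : I -> R^o) (r : R) :
  (forall s : seq I, uniq s -> \sum_(i <- s) `|f i| <= r) ->
  exists2 b : l1 R I, l1_fun b = f & l1norm b <= r.
Proof.
move=> hs; have hle := @esum_le_of_seq R I (fun i => `|f i|) r hs.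
have sf : f \in l1_pred (R := R) (I := I).
  by apply/asboolP; rewrite /summable (le_lt_trans hle) // ltry.
by exists (L1 sf) => //; rewrite -lee_fin -l1normE.
Qed.

Lemma l1norm_ge0 (b : l1 R I) : 0 <= l1norm b.
Proof. by have := @sum_l1norm b [::] isT; rewrite big_nil. Qed.

End L1Norm.

Section NatSums.
Context {R : realType}.
Implicit Types (u b : nat -> R^o).

Lemma sum_uniq_sub (I : eqType) (f : I -> R) (s s' : seq I) : (forall i, 0 <= f i) ->
  uniq s -> uniq s' -> {subset s <= s'} -> \sum_(i <- s) f i <= \sum_(i <- s') f i.
Proof.
move=> f0 us us' ss'; rewrite [leRHS](bigID (mem s)) /= -[leLHS]addr0 lerD ?sumr_ge0 //.
rewrite -[leRHS]big_filter le_eqVlt; apply/orP; left; apply/eqP; apply: perm_big.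
apply: uniq_perm => //; first by rewrite filter_uniq.
by move=> i; rewrite mem_filter /=; case: (boolP (i \in s)) => //= /ss' ->.
Qed.

Lemma mem_le_bigmax (s : seq nat) i : i \in s -> (i <= \max_(k <- s) k)%N.
Proof. by move=> si; rewrite (big_rem i) //= leq_maxl. Qed.

Lemma sum_seq_nat_le (f : nat -> R) (r : R) : (forall i, 0 <= f i) ->
  (forall n, \sum_(i < n) f i <= r) ->
  forall s : seq nat, uniq s -> \sum_(i <- s) f i <= r.
Proof.
move=> f0 hn s us; apply: le_trans (hn (\max_(k <- s) k).+1).
rewrite -(big_mkord xpredT) /=; apply: sum_uniq_sub => //; first exact: iota_uniq.
by move=> i si; rewrite mem_index_iota ltnS mem_le_bigmax.
Qed.

(** Every finite set of pairs lies in a square, so square partial sums suffice. *)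
Lemma sum_seq_nat2_le (f : nat * nat -> R) (r : R) : (forall i, 0 <= f i) ->
  (forall n, \sum_(i < n) \sum_(j < n) f (i : nat, j : nat) <= r) ->
  forall s : seq (nat * nat), uniq s -> \sum_(i <- s) f i <= r.
Proof.
move=> f0 hn s us.
pose n := maxn (\max_(k <- unzip1 s) k).+1 (\max_(k <- unzip2 s) k).+1.
apply: le_trans (hn n); rewrite -(big_mkord xpredT (fun i => \sum_(j < n) f (i, j : nat))) /=.
under [leRHS]eq_bigr do rewrite -(big_mkord xpredT (fun j => f (_, j))).
rewrite -big_allpairs.
apply: sum_uniq_sub => //.
  by apply: allpairs_uniq; rewrite ?iota_uniq // => -[? ?] [? ?] _ _ [-> ->].
move=> [i j] sij; apply/allpairsP; exists (i, j); rewrite !mem_index_iota /n !leq_max !ltnS.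
by split=> //; apply/orP; [left|right]; apply: mem_le_bigmax; apply/mapP; exists (i, j).
Qed.

Lemma l1_nat_ofP u (r : R) : (forall n, \sum_(i < n) `|u i| <= r) ->
  exists2 b : l1 R nat, l1_fun b = u & l1norm b <= r.
Proof.
by move=> h; apply: l1_ofP => s; apply: (@sum_seq_nat_le (fun i => `|u i|)).
Qed.

Lemma sum_l1norm_nat (b : l1 R nat) n : \sum_(i < n) `|b i| <= l1norm b.
Proof.
by rewrite -(big_mkord xpredT (fun i => `|b i|)); apply: sum_l1norm; exact: iota_uniq.
Qed.

(** Trades the summability clause and the square root in [l2ball] for a bound on partial sums, the
    form in which the gauge norm is handled. *)
Lemma l2ballP b : l2ball b <-> forall n, \sum_(i < n) b i ^+ 2 <= 1.
Proof.
have sq : (\esum_(i in [set: nat]) `|(b i ^+ 2 : R)%:E|)%E =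
          (\esum_(i in [set: nat]) (b i ^+ 2)%:E)%E.
  by apply: eq_esum => i _; rewrite /= ger0_norm ?sqr_ge0.
split=> [[sb] | hb].
  have := sb; rewrite summableE sq => fb; rewrite /l2norm.
  set S := fine _ => hS n.
  have S0 : 0 <= S by apply: fine_ge0; apply: esum_ge0 => i _; rewrite lee_fin sqr_ge0.
  have {hS} : S <= 1 by rewrite -(sqr_sqrtr S0) expr_le1 ?sqrtr_ge0.
  apply: le_trans; rewrite -lee_fin fineK // -(big_mkord xpredT (fun i => b i ^+ 2)).
  by apply: (@esum_ge_of_seq R nat (fun i => b i ^+ 2)); exact: iota_uniq.
have hle : (\esum_(i in [set: nat]) (b i ^+ 2)%:E <= 1%:E)%E.
  apply: (@esum_le_of_seq R nat (fun i => b i ^+ 2)) => s.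
  by apply: (@sum_seq_nat_le (fun i => b i ^+ 2)) => // i; exact: sqr_ge0.
have sb : summable [set: nat] (fun i => (b i ^+ 2 : R)%:E).
  by rewrite /summable sq (le_lt_trans hle) // ltry.
split=> //; rewrite /l2norm -[leRHS]sqrtr1 ler_sqrt // -lee_fin fineK //.
by rewrite -sq -summableE.
Qed.

End NatSums.

(** * The gauge norm and its gradient *)

Section Gauge.
Context {R : realType}.
Variable Phi : nat -> R.
Implicit Types (u b z g : nat -> R^o).

(** The set whose infimum is [gauge_norm Phi z]. *)
Definition gauge_set z : set R :=
  [set t : R | 0 < t /\
    exists2 a, [set l1_fun b + diag_op Phi a | b in nball (@l1norm R nat) & a in @l2ball R] a
      & z = t *: a].

(** The decomposition is multiplied by t, so that z itself is [u + Phi * b] with both norms at most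
    t. Upper bounds on the gauge norm then amount to exhibiting such a pair, lower bounds to testing
    all of them. *)
Lemma gauge_setP z t : gauge_set z t <->
  0 < t /\ exists u b,
    [/\ forall n, \sum_(i < n) `|u i| <= t, forall n, \sum_(i < n) b i ^+ 2 <= t ^+ 2
      & forall i, z i = u i + Phi i * b i].
Proof.
split.
  move=> [t0 [_ [b b1 [a /l2ballP a1 <-]] ->]]; split=> //.
  exists (t *: l1_fun b), (t *: a); split=> [n|n|i].
  - under eq_bigr do rewrite normrZ gtr0_norm //.
    rewrite -mulr_sumr -[leRHS]mulr1 ler_pM2l //.
    exact: le_trans (sum_l1norm_nat b n) b1.
  - under eq_bigr do rewrite exprMn.
    by rewrite -mulr_sumr -[leRHS]mulr1 ler_pM2l ?exprn_gt0.
  - by rewrite /diag_op /= !fctE /GRing.scale /=; ring.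
move=> [t0 [u [b [hu hb hz]]]]; split=> //.
have [v vE v1] : exists2 v : l1 R nat, l1_fun v = (t^-1 *: u) & l1norm v <= 1.
  apply: l1_nat_ofP => n.
  under eq_bigr do rewrite normrZ gtr0_norm ?invr_gt0 //.
  by rewrite -mulr_sumr mulrC ler_pdivrMr // mul1r.
exists (l1_fun v + diag_op Phi (t^-1 *: b)).
  exists v; first exact: v1.
  exists (t^-1 *: b) => //; apply/l2ballP => n.
  under eq_bigr do rewrite exprMn.
  by rewrite -mulr_sumr mulrC exprVn ler_pdivrMr ?exprn_gt0 // mul1r.
rewrite vE; apply/funext => i; rewrite /diag_op !fctE hz /GRing.scale /=.
by field; rewrite gt_eqF.
Qed.

Lemma gauge_set_lbound z : has_lbound (gauge_set z).
Proof. by exists 0 => t [/ltW]. Qed.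

Lemma gauge_norm_le z t : gauge_set z t -> gauge_norm Phi z <= t.
Proof. by move=> zt; apply: ge_inf zt; exact: gauge_set_lbound. Qed.

Lemma gauge_norm_ge0 z : 0 <= gauge_norm Phi z.
Proof.
rewrite /gauge_norm /minkowski_gauge -/(gauge_set z).
have [e|/set0P ne] := eqVneq (gauge_set z) set0; first by rewrite e inf0.
by apply: lb_le_inf => // t [/ltW].
Qed.

Lemma gauge_set_l1 z r : (forall n, \sum_(i < n) `|z i| <= r) -> 0 < r ->
  gauge_set z r.
Proof.
move=> hz r0; apply/gauge_setP; split=> //; exists z, (fun=> 0); split=> // [n|i].
  by rewrite big1 ?exprn_ge0 ?ltW // => i _; rewrite expr0n.
by rewrite mulr0 addr0.
Qed.

Lemma gauge_norm_le_l1 z r : (forall n, \sum_(i < n) `|z i| <= r) ->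
  gauge_norm Phi z <= r.
Proof.
(* Members of [gauge_set] are positive whereas r may be 0, hence the passage through [r + e]. *)
move=> hz; apply/ler_addgt0Pr => e e0.
have r0 : 0 <= r by have := hz 0%N; rewrite big_ord0.
apply: gauge_norm_le; apply: gauge_set_l1; last exact: ltr_wpDl.
by move=> n; rewrite (le_trans (hz n)) // lerDl ltW.
Qed.

Lemma gauge_normZ_le z r c : (forall n, \sum_(i < n) `|z i| <= r) -> c != 0 ->
  gauge_norm Phi (c *: z) <= `|c| * gauge_norm Phi z.
Proof.
move=> hz c0; have c0' : 0 < `|c| by rewrite normr_gt0.
rewrite mulrC -ler_pdivrMr //; apply: lb_le_inf.
  exists (r + 1); apply: gauge_set_l1 => [n|]; first by rewrite (le_trans (hz n)) // lerDl.
  by rewrite ltr_wpDl //; have := hz 0%N; rewrite big_ord0.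
move=> t /gauge_setP [t0 [u [b [hu hb hzE]]]].
rewrite ler_pdivrMr // mulrC; apply: gauge_norm_le; apply/gauge_setP.
split; first exact: mulr_gt0.
exists (c *: u), (c *: b); split=> [n|n|i].
- by under eq_bigr do rewrite normrZ; rewrite -mulr_sumr ler_pM2l.
- under eq_bigr do rewrite exprMn.
  by rewrite -mulr_sumr exprMn real_normK ?num_real // ler_wpM2l ?sqr_ge0.
- by rewrite !fctE hzE /GRing.scale /=; ring.
Qed.

(* [`|g|_oo + |Phi g|_2] is the dual norm of the gauge norm. *)
Lemma gauge_norm_ge z g r G K : (forall n, \sum_(i < n) `|z i| <= r) ->
    0 < K -> G + K <= 1 -> (forall i, `|g i| <= G) ->
    (forall n, \sum_(i < n) (Phi i * g i) ^+ 2 <= K ^+ 2) ->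
  forall n, \sum_(i < n) g i * z i <= gauge_norm Phi z.
Proof.
move=> hz K0 GK hg hK n; apply: lb_le_inf.
  exists (r + 1); apply: gauge_set_l1 => [k|]; first by rewrite (le_trans (hz k)) // lerDl.
  by rewrite ltr_wpDl //; have := hz 0%N; rewrite big_ord0.
move=> t /gauge_setP [t0 [u [b [hu hb hzE]]]].
have G0 : 0 <= G by apply: le_trans (hg 0%N).
(* Young's inequality with weights [t / (2 * K)] and [K / (2 * t)] replaces Cauchy-Schwarz; since
   |Phi g|_2 <= K and |b|_2 <= t, each of the two terms contributes at most K t / 2. *)
apply: (@le_trans _ _ (G * \sum_(i < n) `|u i| +
    (t / (2 * K) * \sum_(i < n) (Phi i * g i) ^+ 2 + K / (2 * t) * \sum_(i < n) b i ^+ 2))).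
  rewrite !mulr_sumr -!big_split /=; apply: ler_sum => i _; rewrite hzE mulrDr lerD //.
    apply: le_trans (ler_norm _) _; rewrite normrM.
    by rewrite ler_wpM2r // hg.
  rewrite -subr_ge0.
  have -> : t / (2 * K) * (Phi i * g i) ^+ 2 + K / (2 * t) * b i ^+ 2 -
      g i * (Phi i * b i) = (2 * K * t)^-1 * (t * (Phi i * g i) - K * b i) ^+ 2.
    by field; rewrite !gt_eqF.
  by rewrite mulr_ge0 ?sqr_ge0 // invr_ge0 !mulr_ge0 // ltW.
have h1 : G * \sum_(i < n) `|u i| <= G * t by rewrite ler_wpM2l.
have h2 : t / (2 * K) * \sum_(i < n) (Phi i * g i) ^+ 2 <= t / (2 * K) * K ^+ 2.
  by rewrite ler_wpM2l // divr_ge0 ?mulr_ge0 // ltW.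
have h3 : K / (2 * t) * \sum_(i < n) b i ^+ 2 <= K / (2 * t) * t ^+ 2.
  by rewrite ler_wpM2l // divr_ge0 ?mulr_ge0 // ltW.
apply: le_trans (lerD h1 (lerD h2 h3)) _.
have -> : G * t + (t / (2 * K) * K ^+ 2 + K / (2 * t) * t ^+ 2) = (G + K) * t.
  by field; rewrite !gt_eqF.
by rewrite ler_piMl // ltW.
Qed.

End Gauge.

Section Series.
Context {R : realType}.
Implicit Types f g w : nat -> R.

Lemma series_ltn f n : series f n = \sum_(i < n) f i.
Proof. by rewrite /series /= big_mkord. Qed.

Lemma bounded_series_cvg f r : (forall i, 0 <= f i) ->
  (forall n, \sum_(i < n) f i <= r) -> cvgn (series f).
Proof.
move=> f0 fr; apply: nondecreasing_is_cvgn; first exact: nondecreasing_series.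
by exists r => _ [n _ <-]; rewrite series_ltn.
Qed.

Lemma lim_series_le_bound f r : cvgn (series f) ->
  (forall n, \sum_(i < n) f i <= r) -> limn (series f) <= r.
Proof. by move=> cf fr; apply: limr_le => //; apply: nearW => n; rewrite series_ltn. Qed.

Lemma sum_le_lim_series f n : (forall i, 0 <= f i) -> cvgn (series f) ->
  \sum_(i < n) f i <= limn (series f).
Proof.
move=> f0 cf; rewrite -series_ltn; apply: nondecreasing_cvgn_le => //.
exact: nondecreasing_series.
Qed.

Lemma dist_lim_series f g w c W : cvgn (series f) -> cvgn (series g) -> 0 <= c ->
  (forall i, `|f i - g i| <= c * w i) -> (forall n, \sum_(i < n) w i <= W) ->
  `|limn (series f) - limn (series g)| <= c * W.
Proof.
move=> cf cg c0 fg hw; rewrite -lim_seriesB // -lim_norm; last exact: is_cvg_seriesB.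
apply: limr_le; first by apply: is_cvg_norm; exact: is_cvg_seriesB.
apply: nearW => n; rewrite series_ltn.
apply: le_trans (ler_norm_sum _ _ _) _.
apply: (@le_trans _ _ (c * \sum_(i < n) w i)); last by rewrite ler_wpM2l.
by rewrite mulr_sumr; apply: ler_sum => i _; exact: fg.
Qed.

End Series.

Lemma normr_max0B (R : realDomainType) (a b : R) :
  `|Num.max 0 a - Num.max 0 b| <= `|a - b|.
Proof.
rewrite /Num.max; case: ifP => ha; case: ifP => hb; rewrite ?subr0 ?sub0r ?subrr ?normr0 //.
- move/negbT: hb; rewrite -leNgt => hb; rewrite gtr0_norm // gtr0_norm; lra.
- move/negbT: ha; rewrite -leNgt => ha; rewrite normrN gtr0_norm // distrC gtr0_norm; lra.
Qed.

Lemma normr_minB (R : realDomainType) (c a b : R) :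
  `|Num.min c a - Num.min c b| <= `|a - b|.
Proof.
rewrite /Num.min; case: ltP => ha; case: ltP => hb; rewrite ?subrr ?normr0 //.
- by rewrite (ger0_norm (x := c - b)) ?ger0_norm; lra.
- by rewrite (ler0_norm (x := a - c)) ?ler0_norm; lra.
Qed.

(** * Balancing the l_1 part against the l_2 part *)

Section Balance.
Context {R : realType}.
Variables (Phi z : nat -> R) (S r : R) (j0 : nat).
Hypothesis Phi_gt0 : forall j, 0 < Phi j.
Hypothesis Phi_sum : forall n, \sum_(i < n) Phi i ^+ 2 <= S.
Hypothesis z_sum : forall n, \sum_(i < n) `|z i| <= r.
Hypothesis z_j0 : z j0 != 0.

(** The absolute values of the two parts of z obtained by clipping: [|z j|] is
    [excess lam j + Phi j * clipped lam j]. Raising lam moves mass from the l_1 part to the l_2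
    part. *)
Definition excess (lam : R) (j : nat) : R := Num.max 0 (`|z j| - lam * Phi j ^+ 2).
Definition clipped (lam : R) (j : nat) : R := Num.min (`|z j| / Phi j) (lam * Phi j).

Let excess_ge0 lam j : 0 <= excess lam j.
Proof. by rewrite /excess le_max lexx. Qed.

Let excess_cvg (lam : R) : 0 <= lam -> cvgn (series (excess lam)).
Proof.
move=> l0; apply: (@bounded_series_cvg _ _ r) => // n; apply: le_trans (z_sum n).
apply: ler_sum => i _; rewrite /excess ge_max normr_ge0 /= lerBlDr lerDl.
by rewrite mulr_ge0 ?sqr_ge0.
Qed.

Let clipped_ge0 (lam : R) j : 0 <= lam -> 0 <= clipped lam j.
Proof.
by move=> l0; rewrite /clipped le_min divr_ge0 ?mulr_ge0 // ltW.
Qed.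

Let clipped_sqr (lam : R) j : 0 <= lam ->
  clipped lam j ^+ 2 = Num.min ((`|z j| / Phi j) ^+ 2) (lam ^+ 2 * Phi j ^+ 2).
Proof.
move=> l0; rewrite /clipped -exprMn.
have a0 : 0 <= `|z j| / Phi j by rewrite divr_ge0 // ltW.
have b0 : 0 <= lam * Phi j by rewrite mulr_ge0 // ltW.
case: (leP (`|z j| / Phi j) (lam * Phi j)) => h.
  by rewrite min_l // ler_sqr ?nnegrE.
by rewrite min_r // ltW // ltr_sqr ?nnegrE.
Qed.

Let clipped_cvg (lam : R) : 0 <= lam -> cvgn (series (fun j => clipped lam j ^+ 2)).
Proof.
move=> l0; apply: (@bounded_series_cvg _ _ (lam ^+ 2 * S)) => [i|n]; first exact: sqr_ge0.
apply: (@le_trans _ _ (\sum_(i < n) lam ^+ 2 * Phi i ^+ 2)).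
  by apply: ler_sum => i _; rewrite clipped_sqr // ge_min lexx orbT.
by rewrite -mulr_sumr ler_wpM2l ?sqr_ge0.
Qed.

Let FU lam := limn (series (excess lam)).
Let FB lam := limn (series (fun j => clipped lam j ^+ 2)).

Let FU_dist (lam mu : R) : 0 <= lam -> 0 <= mu -> `|FU lam - FU mu| <= `|lam - mu| * S.
Proof.
move=> l0 m0; apply: (@dist_lim_series _ _ _ (fun i => Phi i ^+ 2)) => //; try exact: excess_cvg.
move=> i; rewrite /excess; apply: le_trans (normr_max0B _ _) _.
have -> : `|z i| - lam * Phi i ^+ 2 - (`|z i| - mu * Phi i ^+ 2) = - ((lam - mu) * Phi i ^+ 2) by ring.
by rewrite normrN normrM (ger0_norm (sqr_ge0 (Phi i))).
Qed.

Let FB_dist (lam mu : R) : 0 <= lam -> 0 <= mu -> `|FB lam - FB mu| <= `|lam ^+ 2 - mu ^+ 2| * S.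
Proof.
move=> l0 m0; apply: (@dist_lim_series _ _ _ (fun i => Phi i ^+ 2)) => //; try exact: clipped_cvg.
move=> i; rewrite !clipped_sqr //; apply: le_trans (normr_minB _ _ _) _.
by rewrite -mulrBl normrM (ger0_norm (sqr_ge0 (Phi i))).
Qed.

Let S_ge0 : 0 <= S. Proof. by have := Phi_sum 0; rewrite big_ord0. Qed.

(** Continuity is taken within [[0, L]] because the bounds on [FU] and [FB] hold for nonnegative
    levels. *)
Let sqz_cvg (F : R -> R) (phi : R -> R) (L : R) (lam : R) :
  {for lam, continuous phi} -> 
  (forall mu : R, 0 <= mu -> `|F lam - F mu| <= `|phi lam - phi mu| * S) ->
  F x @[x --> within `[0, L] (nbhs lam)] --> F lam.
Proof.
move=> cphi hF; apply/cvgrPdist_le => e e0.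
have : \forall x \near lam, `|phi lam - phi x| <= e / (S + 1).
  by move/cvgrPdist_le : cphi; apply; rewrite divr_gt0 // ltr_wpDl.
move=> h; near=> x.
apply: le_trans (hF x _) _.
  have : `[0, L]%classic x by near: x; exact: withinT.
  by rewrite /= in_itv /= => /andP[].
apply: (@le_trans _ _ (e / (S + 1) * (S + 1))).
  rewrite ler_pM //; last by rewrite lerDl.
  by near: x; exact: cvg_within.
by rewrite divfK // gt_eqF // ltr_wpDl.
Unshelve. all: by end_near. Qed.

(* The levels at which the l_1 norm of the excess and the l_2 norm of the clipped
   sequence agree; the common value is the gauge norm of z. *)
Lemma balance : exists lam t : R,
  [/\ 0 < lam, 0 < t, series (excess lam) @ \oo --> t
    & series (fun j => clipped lam j ^+ 2) @ \oo --> t ^+ 2].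
Proof.
have z0_gt0 : 0 < `|z j0| by rewrite normr_gt0.
have FU_j0 (lam : R) : 0 <= lam -> excess lam j0 <= FU lam.
  move=> l0; apply: le_trans (sum_le_lim_series j0.+1 (excess_ge0 lam) (excess_cvg l0)).
  by rewrite big_ord_recr /= lerDr sumr_ge0.
have FB_j0 (lam : R) : 0 <= lam -> clipped lam j0 ^+ 2 <= FB lam.
  move=> l0; apply: le_trans (sum_le_lim_series j0.+1 _ (clipped_cvg l0)); last first.
    by move=> i; exact: sqr_ge0.
  by rewrite big_ord_recr /= lerDr sumr_ge0 // => i _; exact: sqr_ge0.
have FU_ge0 (lam : R) : 0 <= lam -> 0 <= FU lam by move=> l0; apply: le_trans (FU_j0 _ l0).
(* c is the unclipped value at [j0]. The cut k leaves a tail of z of l_1 norm at most c, and L is so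
   large that there is no excess before k and no clipping at [j0]; hence [FU L <= c] and
   [c ^+ 2 <= FB L]. *)
pose c := `|z j0| / Phi j0.
have c0 : 0 < c by rewrite divr_gt0.
have cz : cvgn (series (fun i => `|z i|)) by apply: (@bounded_series_cvg _ _ r).
have [k hk] : exists k, limn (series (fun i => `|z i|)) - series (fun i => `|z i|) k <= c.
  have /cvgrPdist_le /(_ _ c0) [k _ hk] := cz.
  by exists k; apply: le_trans (ler_norm _) (hk k _) => /=.
pose L := \sum_(j < k) `|z j| / Phi j ^+ 2 + `|z j0| / Phi j0 ^+ 2.
have q0 j : 0 <= `|z j| / Phi j ^+ 2 by rewrite divr_ge0 ?sqr_ge0.
have L0 : 0 <= L by rewrite addr_ge0 ?sumr_ge0.
have FUL : FU L <= c.
  apply: lim_series_le_bound (excess_cvg L0) _ => n.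
  apply: le_trans hk; rewrite lerBrDr series_ltn.
  apply: le_trans (@sum_le_lim_series _ _ (maxn n k) _ cz) => //.
  have sumE m (f : nat -> R) : (m <= maxn n k)%N ->
      \sum_(i < m) f i = \sum_(i < maxn n k) if (i < m)%N then f i else 0.
    by move=> hm; rewrite (big_ord_widen _ f hm) big_mkcond.
  rewrite (sumE n) ?leq_maxl // (sumE k (fun i => `|z i|)) ?leq_maxr // -big_split /=.
  apply: ler_sum => i _; case: (ltnP i k) => ik.
    suff -> : excess L i = 0 by rewrite if_same add0r.
    rewrite /excess max_l // subr_le0 -ler_pdivrMr ?exprn_gt0 //.
    rewrite /L (bigD1 (Ordinal ik)) //= -addrA lerDl addr_ge0 // sumr_ge0 //.
  rewrite addr0; case: ifP => // _; rewrite /excess ge_max normr_ge0 /= lerBlDr lerDl.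
  by rewrite mulr_ge0 ?sqr_ge0.
have FBL : c ^+ 2 <= FB L.
  apply: le_trans (FB_j0 L L0); rewrite ler_sqr ?nnegrE ?clipped_ge0 ?(ltW c0) //.
  rewrite /clipped le_min lexx /= /c.
  have -> : `|z j0| / Phi j0 = `|z j0| / Phi j0 ^+ 2 * Phi j0 by field; rewrite gt_eqF.
  by rewrite ler_wpM2r ?(ltW (Phi_gt0 _)) // /L lerDr sumr_ge0.
have FB0 : FB 0 = 0.
  rewrite /FB (_ : series _ = fun=> 0) ?lim_cst //; apply/funext => n.
  rewrite series_ltn big1 // => i _; rewrite clipped_sqr // expr0n mul0r min_r //.
  exact: sqr_ge0.
have excess0 : `|z j0| <= FU 0.
  apply: le_trans (FU_j0 0 (lexx 0)); rewrite /excess mul0r subr0 le_max lexx orbT //.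
(* The intermediate value theorem is applied to [FU ^+ 2 - FB], which is nonnegative at 0, where
   everything is excess, and nonpositive at L. *)
have cont : {within `[0, L], continuous (fun x => FU x ^+ 2 - FB x)}.
  apply/subspace_continuousP => x; rewrite /= in_itv /= => /andP[x0 xL].
  apply: cvgB.
    rewrite expr2; apply: cvgM; apply: (@sqz_cvg _ id) => // [mu mu0]; exact: FU_dist.
  apply: (@sqz_cvg _ (fun x => x ^+ 2)) => [|mu mu0]; last exact: FB_dist.
  exact: exprn_continuous.
have D0 : 0 <= FU 0 ^+ 2 - FB 0 by rewrite FB0 subr0 sqr_ge0.
have DL : FU L ^+ 2 - FB L <= 0.
  by rewrite subr_le0 (le_trans _ FBL) // ler_sqr ?nnegrE ?FU_ge0 // ltW.
have [|lam] := IVT L0 cont (v := 0).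
  by rewrite ge_min le_max D0 DL !orbT.
rewrite in_itv /= => /andP[l0 _] /eqP; rewrite subr_eq0 => /eqP FUB.
(* Neither lam nor [FU lam] vanishes: at level 0 the excess is all of z while [FB] is 0, and at a
   positive level the clipped value at [j0] is positive. *)
have lam0 : 0 < lam.
  rewrite lt_neqAle l0 andbT; apply/eqP => e; move: FUB; rewrite -e FB0.
  by move/eqP; rewrite sqrf_eq0 => /eqP h; move: excess0; rewrite h leNgt z0_gt0.
have t0 : 0 < FU lam.
  rewrite lt_neqAle FU_ge0 // andbT; apply/eqP => e; move: FUB; rewrite -e expr0n /= => FB0'.
  have := FB_j0 lam l0; rewrite -FB0' leNgt exprn_gt0 // /clipped lt_min.
  by rewrite divr_gt0 // mulr_gt0.
exists lam, (FU lam); split=> //; first exact: excess_cvg.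
rewrite FUB; exact: clipped_cvg.
Qed.

End Balance.

Section FiniteSums.
Context {R : realType}.
Implicit Types f : nat -> R.

Lemma sum_ord_ext f N n : (N <= n)%N -> (forall i, (N <= i)%N -> f i = 0) ->
  \sum_(i < n) f i = \sum_(i < N) f i.
Proof.
move=> Nn f0; rewrite (big_ord_widen n f Nn) [RHS]big_mkcond.
apply: eq_bigr => i _ /=; case: ltnP => // /f0 //.
Qed.

Lemma sum_ord_le_mono f n N : (forall i, 0 <= f i) -> (n <= N)%N ->
  \sum_(i < n) f i <= \sum_(i < N) f i.
Proof.
move=> f0 nN; rewrite (big_ord_widen N f nN) [leLHS]big_mkcond /=.
by apply: ler_sum => i _; case: ifP.
Qed.

Lemma sum_ord_le_eventually f N B : (forall i, 0 <= f i) ->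
  (forall n, (N <= n)%N -> \sum_(i < n) f i <= B) -> forall n, \sum_(i < n) f i <= B.
Proof.
move=> f0 fB n; apply: le_trans (fB (maxn n N) (leq_maxr _ _)).
by apply: sum_ord_le_mono => //; exact: leq_maxl.
Qed.

Lemma sum_ord_delta n j (x : R) : (j < n)%N -> \sum_(i < n) (if i == j :> nat then x else 0) = x.
Proof.
move=> jn; rewrite (bigD1 (Ordinal jn)) //= eqxx big1 ?addr0 // => i ij.
by rewrite ifF //; apply/negbTE; apply: contra ij => /eqP ij; apply/eqP/val_inj.
Qed.

Lemma sum_ord_cut f n k : (k <= n)%N -> \sum_(i < n) (if (i < k)%N then f i else 0) = \sum_(i < k) f i.
Proof. by move=> kn; rewrite (big_ord_widen n f kn) [RHS]big_mkcond. Qed.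

End FiniteSums.

(** * The gradient of the gauge norm *)

Section Gradient.
Context {R : realType}.
Variables (Phi : nat -> R) (z : nat -> R) (s r : R).
Hypothesis Phi_gt0 : forall j, 0 < Phi j.
Hypothesis s_ge0 : 0 <= s.
Hypothesis Phi_sum : forall n, \sum_(i < n) Phi i ^+ 2 <= s ^+ 2.
Hypothesis z_sum : forall n, \sum_(i < n) `|z i| <= r.
Variables (lam t : R).
Hypothesis lam_gt0 : 0 < lam.
Hypothesis t_gt0 : 0 < t.
Hypothesis excess_sum : series (excess Phi z lam) @ \oo --> t.
Hypothesis clipped_sum : series (fun j => clipped Phi z lam j ^+ 2) @ \oo --> t ^+ 2.

Local Notation exc := (excess Phi z lam).
Local Notation clp := (clipped Phi z lam).

(** The norming functional of z: its supremum norm is at most [lam / (t + lam)], its product with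
    [Phi] has l_2 norm at most [t / (t + lam)], and these two bounds add up to 1. *)
Definition gradient (j : nat) : R := Num.sg (z j) * clp j / (Phi j * (t + lam)).

Let exc_ge0 j : 0 <= exc j. Proof. by rewrite /excess le_max lexx. Qed.

Let clp_ge0 j : 0 <= clp j.
Proof. by rewrite /clipped le_min divr_ge0 ?mulr_ge0 // ltW. Qed.

Let tl_gt0 : 0 < t + lam. Proof. exact: addr_gt0. Qed.

Let exc_clp j : exc j + Phi j * clp j = `|z j|.
Proof.
have P0 := Phi_gt0 j; rewrite /excess /clipped.
have e : (`|z j| / Phi j <= lam * Phi j) = (`|z j| - lam * Phi j ^+ 2 <= 0).
  by rewrite ler_pdivrMr // subr_le0 -mulrA -expr2.
case: (leP (`|z j| / Phi j) (lam * Phi j)) => h.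
  by rewrite max_l -?e // add0r mulrC divfK // gt_eqF.
by rewrite max_r; [ring|rewrite ltW // ltNge -e -ltNge].
Qed.

Let sg_norm (x : R) : Num.sg x * `|x| = x. Proof. by rewrite -numEsg. Qed.

Let z_decomp j : z j = Num.sg (z j) * exc j + Phi j * (Num.sg (z j) * clp j).
Proof. by rewrite -[LHS]sg_norm -exc_clp; ring. Qed.

Let exc_part n : \sum_(i < n) exc i <= t.
Proof.
rewrite -(cvg_lim _ excess_sum) //; apply: sum_le_lim_series => //.
by apply/cvg_ex; exists t.
Qed.

Let clp_part n : \sum_(i < n) clp i ^+ 2 <= t ^+ 2.
Proof.
rewrite -(cvg_lim _ clipped_sum) //; apply: (@sum_le_lim_series _ (fun i => clp i ^+ 2)) => //.
  by move=> i; exact: sqr_ge0.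
by apply/cvg_ex; exists (t ^+ 2).
Qed.

Let sg_le1 (x : R) : `|Num.sg x| <= 1.
Proof. by rewrite normr_sg lern1; case: (x != 0). Qed.

Let u_part n : \sum_(i < n) `|Num.sg (z i) * exc i| <= t.
Proof.
apply: le_trans (exc_part n); apply: ler_sum => i _.
by rewrite normrM (ger0_norm (exc_ge0 i)) ler_piMl.
Qed.

Let sqr_sgM_le (x y : R) : (Num.sg x * y) ^+ 2 <= y ^+ 2.
Proof.
rewrite exprMn ler_piMl ?sqr_ge0 // -real_normK ?num_real //.
by rewrite expr_le1.
Qed.

Let b_part n : \sum_(i < n) (Num.sg (z i) * clp i) ^+ 2 <= t ^+ 2.
Proof. by apply: le_trans (clp_part n); apply: ler_sum => i _; exact: sqr_sgM_le. Qed.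

Lemma gradient_abs j : `|gradient j| <= lam / (t + lam).
Proof.
have P0 := Phi_gt0 j.
rewrite /gradient normrM normfV (gtr0_norm (mulr_gt0 P0 tl_gt0)) normrM.
rewrite (ger0_norm (clp_ge0 j)) ler_pdivrMr ?mulr_gt0 //.
have -> : lam / (t + lam) * (Phi j * (t + lam)) = lam * Phi j by field; rewrite gt_eqF.
apply: (@le_trans _ _ (clp j)); first by rewrite ler_piMl.
by rewrite /clipped ge_min lexx orbT.
Qed.

Lemma gradient_le1 j : `|gradient j| <= 1.
Proof. by rewrite (le_trans (gradient_abs j)) // ler_pdivrMr // mul1r lerDr ltW. Qed.

(** The clipped decomposition gives one inequality. The other is duality: the gradient has dual norm
    at most 1 and its pairing with z is t. *)
Lemma gauge_norm_balance : gauge_norm Phi z = t.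
Proof.
apply/eqP; rewrite eq_le; apply/andP; split.
  apply: gauge_norm_le; apply/gauge_setP; split=> //.
  by exists (fun i => Num.sg (z i) * exc i), (fun i => Num.sg (z i) * clp i).
have cv : series (fun j => gradient j * z j) @ \oo --> t.
  have -> : t = (lam * t + t ^+ 2) / (t + lam) by field; rewrite gt_eqF.
  have -> : series (fun j => gradient j * z j) =
      (fun n => (lam * series exc n + series (fun j => clp j ^+ 2) n) / (t + lam)).
    apply/funext => n; rewrite !series_ltn mulr_sumr -big_split /= mulr_suml.
    apply: eq_bigr => i _; have P0 := Phi_gt0 i.
    (* Where the excess is nonzero, [clp] equals its ceiling [lam * Phi]. *)
    have e : clp i * exc i = lam * Phi i * exc i.
      rewrite /excess /clipped; case: (leP (`|z i| / Phi i) (lam * Phi i)) => h //.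
      rewrite max_l ?mulr0 //; move: h; rewrite ler_pdivrMr //.
      by rewrite subr_le0 -mulrA -expr2.
    rewrite -{1}(sg_norm (z i)) /gradient.
    have -> : Num.sg (z i) * clp i / (Phi i * (t + lam)) * (Num.sg (z i) * `|z i|) =
        Num.sg (z i) ^+ 2 * `|z i| * clp i / (Phi i * (t + lam)).
      by field; rewrite !gt_eqF.
    rewrite sqr_sg.
    have -> : (z i != 0)%:R * `|z i| = `|z i|.
      by have [->|_] := eqVneq (z i) 0; rewrite ?normr0 ?mulr0 ?mul1r.
    rewrite -exc_clp mulrDl (mulrC (exc i)) e.
    by field; rewrite !gt_eqF.
  apply: cvgMl; apply: cvgD => //.
  exact: cvgMr.
rewrite -[leLHS](cvg_lim _ cv) //; apply: lim_series_le_bound.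
  by apply/cvg_ex; exists t.
apply: (@gauge_norm_ge _ _ _ _ r (lam / (t + lam)) (t / (t + lam))) => //.
- exact: divr_gt0.
- by rewrite -mulrDl addrC divff // gt_eqF.
- exact: gradient_abs.
move=> n; rewrite expr_div_n.
apply: (@le_trans _ _ ((\sum_(i < n) (Num.sg (z i) * clp i) ^+ 2) / (t + lam) ^+ 2)).
  rewrite mulr_suml; apply: ler_sum => i _; rewrite /gradient.
  have P0 := Phi_gt0 i; rewrite le_eqVlt; apply/orP; left; apply/eqP.
  by field; rewrite !gt_eqF.
by rewrite ler_pM2r ?invr_gt0 ?exprn_gt0.
Qed.

(** Since [clp j <= t <= r], a ratio [|z j| / Phi j] above r must be clipped, which fixes the
    modulus of the gradient. Moreover [clp <= lam * Phi] gives [t <= lam * s], whence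
    [lam / (t + lam) >= 1 / (1 + s) >= 1 - s]. *)
Lemma gradient_saturated j : r < `|z j| / Phi j ->
  gradient j = Num.sg (z j) * (lam / (t + lam)) /\ 1 - s <= lam / (t + lam) <= 1.
Proof.
move=> hj; have P0 := Phi_gt0 j.
have t_le : t <= r by rewrite -gauge_norm_balance; exact: gauge_norm_le_l1.
have clp_le : clp j <= t.
  rewrite -ler_sqr ?nnegrE //; last exact: ltW.
  apply: le_trans (clp_part j.+1); rewrite big_ord_recr /= lerDr.
  by apply: sumr_ge0 => i _; exact: sqr_ge0.
have clpE : clp j = lam * Phi j.
  move: clp_le; rewrite /clipped; case: (leP (`|z j| / Phi j) (lam * Phi j)) => // h1 h2.
  by have := lt_le_trans hj (le_trans h2 t_le); rewrite ltxx.
split; first by rewrite /gradient clpE; field; rewrite !gt_eqF.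
have t_ls : t <= lam * s.
  rewrite -ler_sqr ?nnegrE ?mulr_ge0 ?(ltW t_gt0) ?(ltW lam_gt0) //.
  rewrite -(cvg_lim _ clipped_sum) //; apply: lim_series_le_bound.
    by apply/cvg_ex; exists (t ^+ 2).
  move=> n; rewrite exprMn; apply: (@le_trans _ _ (\sum_(i < n) lam ^+ 2 * Phi i ^+ 2)).
    apply: ler_sum => i _; rewrite -exprMn ler_sqr ?nnegrE ?mulr_ge0 ?(ltW (Phi_gt0 _)) ?(ltW lam_gt0) //.
    by rewrite /clipped ge_min lexx orbT.
  by rewrite -mulr_sumr ler_wpM2l ?sqr_ge0.
rewrite ler_pdivrMr // mul1r lerDr (ltW t_gt0) andbT ler_pdivlMr //.
have := mulr_ge0 s_ge0 (ltW t_gt0); nra.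
Qed.

(** The whole perturbation goes into the l_1 part. The bound is crude but valid for every tau, and
    will control the tail of the series in p. *)
Lemma gauge_norm_shift_le (h : nat -> R) (H tau : R) : (forall n, \sum_(i < n) `|h i| <= H) ->
  gauge_norm Phi (fun i => z i + tau * h i) <= t + `|tau| * H.
Proof.
move=> hH; have H0 : 0 <= H by have := hH 0; rewrite big_ord0.
apply: gauge_norm_le; apply/gauge_setP; split; first by rewrite ltr_wpDr // mulr_ge0.
exists (fun i => Num.sg (z i) * exc i + tau * h i), (fun i => Num.sg (z i) * clp i); split.
- move=> n; apply: (@le_trans _ _ (\sum_(i < n) (`|Num.sg (z i) * exc i| + `|tau| * `|h i|))).
    by apply: ler_sum => i _; apply: le_trans (ler_normD _ _) _; rewrite (normrM tau).
  rewrite big_split /= -mulr_sumr; apply: lerD; [exact: u_part|by apply: ler_wpM2l => //; exact: hH].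
- move=> n; apply: le_trans (b_part n) _; rewrite ler_sqr ?nnegrE ?(ltW t_gt0) //.
    by rewrite lerDl mulr_ge0.
  by rewrite addr_ge0 ?mulr_ge0 // ltW.
- move=> i; rewrite {1}z_decomp; ring.
Qed.

(* Perturbing the l_2 part along h changes its norm, but not that of the l_1 part.
   Moving the mass tau * c * sg at one coordinate j0 of the support of the l_1 part
   from one part to the other makes both norms grow at the same rate c = <g, h>. *)
Lemma gauge_norm_upper_derivative (h : nat -> R) k (Hk : R) :
    (forall n, \sum_(i < n) (if (i < k)%N then 0 else `|h i|) <= Hk) ->
  exists C d : R, [/\ 0 <= C, 0 < d & forall tau : R, `|tau| <= d ->
    gauge_norm Phi (fun i => z i + tau * h i) <=
      t + tau * \sum_(j < k) gradient j * h j + `|tau| * Hk + C * tau ^+ 2].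
Proof.
move=> hH; have H0 : 0 <= Hk by have := hH 0; rewrite big_ord0.
(* The excess has positive sum t, so it is positive somewhere; there clipping is active. *)
have [j0 ej0] : exists j, 0 < exc j.
  apply: contrapT => hn; have : series exc = fun=> 0.
    apply/funext => n; rewrite series_ltn big1 // => i _; apply/eqP; rewrite eq_le exc_ge0 andbT.
    by rewrite leNgt; apply/negP => hi; apply: hn; exists i.
  move=> e; move: excess_sum; rewrite e => /(cvg_lim (@Rhausdorff R)).
  by rewrite lim_cst // => e'; move: t_gt0; rewrite -e' ltxx.
have P0 := Phi_gt0 j0.
have clpE : clp j0 = lam * Phi j0.
  move: ej0; rewrite /excess lt_max ltxx /= subr_gt0 => h0.
  by rewrite /clipped min_r // ler_pdivlMr // -mulrA -expr2 ltW.
pose sg : R := Num.sg (z j0).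
have sg2 : sg * sg = 1.
  rewrite -expr2 sqr_sg; have [e|//] := eqVneq (z j0) 0.
  by move: ej0; rewrite /excess e normr0 lt_max ltxx sub0r oppr_gt0 ltNge mulr_ge0 ?sqr_ge0 // ltW.
have nsg : `|sg| = 1.
  by apply/eqP; rewrite -sqrp_eq1 // real_normK ?num_real // expr2 sg2.
pose c : R := \sum_(j < k) gradient j * h j.
(* The direction in which the l_2 part moves: [h / Phi] on the first k coordinates, corrected at
   [j0] by the mass handed over to the l_1 part. *)
pose d j : R := (if (j < k)%N then h j / Phi j else 0) - (if j == j0 then c * sg / Phi j0 else 0).
pose N := maxn k j0.+1.
pose D : R := \sum_(i < N) d i ^+ 2.
have D0 : 0 <= D by apply: sumr_ge0 => i _; exact: sqr_ge0.
(* For [|tau| <= dl] the new radius stays positive and [|tau * c|] is at most the excess at [j0], so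
   that the l_1 part does not change sign there. *)
pose dl : R := Num.min (t / 2) (exc j0) / (`|c| + 1).
have c1 : 0 < `|c| + 1 by rewrite ltr_wpDl.
exists (D / t), dl; split.
- by rewrite divr_ge0 // ltW.
- by rewrite divr_gt0 // lt_min ej0 divr_gt0.
move=> tau htau.
have tc : `|tau * c| <= Num.min (t / 2) (exc j0).
  rewrite normrM; move: htau; rewrite ler_pdivlMr // => ht.
  by apply: le_trans ht; rewrite ler_wpM2l // lerDl.
have /andP[tc1 tc2] : (- (t / 2) <= tau * c) && (- exc j0 <= tau * c).
  move: tc; rewrite le_min !ler_norml => /andP[/andP[-> _] /andP[-> _]] //.
have Hk' : 0 <= `|tau| * Hk by rewrite mulr_ge0.
have Dt : 0 <= D / t * tau ^+ 2 by rewrite mulr_ge0 ?sqr_ge0 // divr_ge0 // ltW.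
rewrite -/c; apply: gauge_norm_le; apply/gauge_setP; split.
  by have := t_gt0; lra.
(* The coordinates of h from k on are absorbed by the l_1 part, at the cost [|tau| * Hk]. *)
pose u' j : R := Num.sg (z j) * exc j + (if j == j0 then tau * c * sg else 0) +
                 (if (j < k)%N then 0 else tau * h j).
pose b' j : R := Num.sg (z j) * clp j + tau * d j.
exists u', b'; split.
- apply: (@sum_ord_le_eventually R (fun i => `|u' i|) N) => [i|n Nn]; first exact: normr_ge0.
  have jn : (j0 < n)%N by apply: leq_trans Nn; exact: leq_maxr.
  apply: (@le_trans _ _ (\sum_(i < n) (exc i + (if i == j0 :> nat then tau * c else 0) +
                    `|tau| * (if (i < k)%N then 0 else `|h i|)))).
    apply: ler_sum => i _; apply: le_trans (ler_normD _ _) _; apply: lerD; last first.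
      by case: ifP => _; rewrite ?normr0 ?mulr0 // normrM.
    case: eqP => [->|_]; last first.
      by rewrite !addr0 normrM (ger0_norm (exc_ge0 i)) ler_piMl.
    rewrite -/sg (mulrC _ sg) -mulrDr normrM nsg mul1r ger0_norm // -lerBlDl sub0r //.
  rewrite !big_split /= -mulr_sumr sum_ord_delta //.
  have := exc_part n; have := ler_wpM2l (normr_ge0 tau) (hH n); lra.
- apply: (@sum_ord_le_eventually R (fun i => b' i ^+ 2) N) => [i|n Nn]; first exact: sqr_ge0.
  have jn : (j0 < n)%N by apply: leq_trans Nn; exact: leq_maxr.
  have kn : (k <= n)%N by apply: leq_trans Nn; exact: leq_maxl.
  have e1 : \sum_(i < n) d i ^+ 2 = D.
    apply: (@sum_ord_ext _ (fun i => d i ^+ 2)) => // i; rewrite /N geq_max => /andP[ki ji].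
    by rewrite /d ltnNge ki /= gtn_eqF // subr0 expr0n.
  (* The pairing with d consists of [(t + lam) * c] from h and [- (lam * c)] from the correction at
     [j0]; hence the l_2 norm, too, grows at rate c. *)
  have e2 : \sum_(i < n) (Num.sg (z i) * clp i) * d i = t * c.
    rewrite (eq_bigr (fun i : 'I_n =>
      (if (i < k)%N then (t + lam) * (gradient i * h i) else 0) -
      (if i == j0 :> nat then lam * c else 0))).
      rewrite sumrB sum_ord_delta //.
      rewrite (@sum_ord_cut _ (fun i => (t + lam) * (gradient i * h i))) //.
      by rewrite -mulr_sumr -/c; ring.
    move=> i _; rewrite /d mulrBr; congr (_ - _).
      by case: ifP => _; rewrite ?mulr0 // /gradient; field; rewrite !gt_eqF.
    case: eqP => [->|_]; rewrite ?mulr0 // clpE -/sg.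
    have -> : sg * (lam * Phi j0) * (c * sg / Phi j0) = sg * sg * (lam * c) by field; rewrite gt_eqF.
    by rewrite sg2 mul1r.
  have -> : \sum_(i < n) b' i ^+ 2 =
     \sum_(i < n) (Num.sg (z i) * clp i) ^+ 2 + 2 * tau * (t * c) + tau ^+ 2 * D.
    rewrite -e1 -e2 !mulr_sumr -!big_split /=; apply: eq_bigr => i _; rewrite /b'; ring.
  apply: (@le_trans _ _ (t ^+ 2 + 2 * tau * (t * c) + tau ^+ 2 * D)).
    by rewrite !lerD2r.
  (* With [w = tau * c], the square of [t + w + X + Y] exceeds [t ^+ 2 + 2 * t * w] by at least
     [t * (X + Y)], because [t + 2 * w >= 0]; the constant [D / t] makes [t * Y] the quadratic
     term. *)
  set X := `|tau| * Hk in Hk' *; set Y := D / t * tau ^+ 2 in Dt *.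
  have YE : t * Y = tau ^+ 2 * D by rewrite /Y; field; rewrite gt_eqF.
  rewrite -YE; set w := tau * c in tc1 *.
  have -> : 2 * tau * (t * c) = 2 * t * w by rewrite /w; ring.
  have : 0 <= (t + 2 * w) * (X + Y) by apply: mulr_ge0; [have := t_gt0; lra|exact: addr_ge0].
  have : 0 <= t * X by rewrite mulr_ge0 // ltW.
  have := sqr_ge0 w; have := sqr_ge0 (X + Y); nra.
- move=> i; suff e : z i + tau * h i = u' i + Phi i * b' i by exact: e.
  rewrite {1}z_decomp /u' /b' /d; have Pi := Phi_gt0 i.
  by have [->|_] := eqVneq i j0; case: ltnP => _; field; rewrite ?gt_eqF.
Qed.

End Gradient.

(** Hides the level lam. Only upper estimates of the increments are kept: at a minimum along a line,
    applied with both signs of tau, they force the derivative to vanish. *)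
Lemma exists_gradient (R : realType) (Phi z : nat -> R) (s r : R) (j0 : nat) :
    (forall j, 0 < Phi j) -> 0 <= s -> (forall n, \sum_(i < n) Phi i ^+ 2 <= s ^+ 2) ->
    (forall n, \sum_(i < n) `|z i| <= r) -> z j0 != 0 ->
  exists g : nat -> R,
    [/\ forall j, `|g j| <= 1,
        forall j, r < `|z j| / Phi j ->
          exists2 G : R, 1 - s <= G <= 1 & g j = Num.sg (z j) * G,
        forall (h : nat -> R) (H tau : R), (forall n, \sum_(i < n) `|h i| <= H) ->
          gauge_norm Phi (fun i => z i + tau * h i) <= gauge_norm Phi z + `|tau| * H
      & forall (h : nat -> R) k (H : R),
          (forall n, \sum_(i < n) (if (i < k)%N then 0 else `|h i|) <= H) ->
        exists C d : R, [/\ 0 <= C, 0 < d & forall tau : R, `|tau| <= d ->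
          gauge_norm Phi (fun i => z i + tau * h i) <=
          gauge_norm Phi z + tau * (\sum_(j < k) g j * h j) + `|tau| * H + C * tau ^+ 2]].
Proof.
move=> P0 s0 Ps zs zj0; have [lam [t [l0 t0 ce cc]]] := balance P0 Ps zs zj0.
exists (gradient Phi z lam t); rewrite (gauge_norm_balance P0 zs l0 t0 ce cc); split.
- by move=> j; apply: gradient_le1.
- move=> j hj; have [-> G1] := gradient_saturated P0 s0 Ps zs l0 t0 ce cc hj.
  by exists (lam / (t + lam)).
- by move=> h H tau hH; apply: (gauge_norm_shift_le P0 t0 ce cc tau hH).
- by move=> h k H hH; apply: (gauge_norm_upper_derivative P0 l0 t0 ce cc hH).
Qed.

(** * Dual norms and Gateaux derivatives *)

Section NormFacts.
Context {R : realType} {V : lmodType R}.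
Variable N : V -> R.
Hypothesis N_norm : is_norm N.

Lemma is_normD x y : N (x + y) <= N x + N y. Proof. by case: N_norm. Qed.
Lemma is_normZ (a : R) x : N (a *: x) = `|a| * N x. Proof. by case: N_norm. Qed.
Lemma is_norm_eq0 x : N x = 0 -> x = 0. Proof. by case: N_norm => _ _; apply. Qed.
Lemma is_norm0 : N 0 = 0. Proof. by rewrite -(scale0r 0) is_normZ normr0 mul0r. Qed.
Lemma is_normN x : N (- x) = N x. Proof. by rewrite -scaleN1r is_normZ normrN1 mul1r. Qed.
Lemma is_norm_ge0 x : 0 <= N x.
Proof.
have := is_normD x (- x); rewrite subrr is_norm0 is_normN -mulr2n.
by rewrite pmulrn_lge0.
Qed.
Lemma is_norm_gt0 x : x != 0 -> 0 < N x.
Proof.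
move=> x0; rewrite lt_neqAle is_norm_ge0 andbT; apply: contra_neq x0 => e.
by apply: is_norm_eq0.
Qed.

Lemma dualD (f g : dual N) x : (f + g) x = f x + g x :> R. Proof. by []. Qed.
Lemma dualN (f : dual N) x : (- f) x = - f x :> R. Proof. by []. Qed.
Lemma dualZ (a : R) (f : dual N) x : (a *: f) x = a * f x :> R. Proof. by []. Qed.
Lemma dual0 x : (0 : dual N) x = 0 :> R. Proof. by []. Qed.
Lemma dual_sum (I : Type) (s : seq I) (F : I -> dual N) x :
  (\sum_(i <- s) F i) x = \sum_(i <- s) (F i x : R) :> R.
Proof. by elim/big_ind2: _ => // f a g b <- <-. Qed.

Lemma dual_linear (f : dual N) : linear f.
Proof. by case: f => f /= /asboolP[]. Qed.
Lemma dual_fun0 (f : dual N) : f 0 = 0 :> R.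
Proof.
have := dual_linear f 1 0 0; rewrite scale1r addr0 scale1r => e.
by apply: (addrI (f 0)); rewrite addr0 -e.
Qed.
Lemma dual_funD (f : dual N) x y : f (x + y) = f x + f y :> R.
Proof. by have := dual_linear f 1 x y; rewrite !scale1r. Qed.
Lemma dual_funZ (f : dual N) (a : R) x : f (a *: x) = a * f x :> R.
Proof. by have := dual_linear f a x 0; rewrite !addr0 dual_fun0 addr0. Qed.
Lemma dual_funN (f : dual N) x : f (- x) = - f x :> R.
Proof. by rewrite -scaleN1r dual_funZ mulN1r. Qed.
Lemma dual_bounded (f : dual N) : exists C : R, forall x, `|f x| <= C * N x.
Proof. by case: f => f /= /asboolP[]. Qed.

Lemma mk_dual (f : V -> R^o) (C : R) : linear f -> (forall x, `|f x| <= C * N x) ->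
  exists g : dual N, dual_fun g = f.
Proof.
move=> lf bf; have df : f \in dual_pred N by apply/asboolP; split=> //; exists C.
by exists (Dual df).
Qed.

Lemma dual_eq (f g : dual N) : (forall x, f x = g x) -> f = g.
Proof. by move=> e; apply: val_inj; apply/funext. Qed.

Lemma dual_norm_has_sup (f : dual N) :
  has_sup [set `|f x| | x in nball N].
Proof.
split; first by exists `|f 0|; exists 0 => //; rewrite /nball /= is_norm0.
have [C hC] := dual_bounded f; exists `|C| => _ [x x1 <-].
apply: le_trans (hC x) _; apply: (@le_trans _ _ (`|C| * N x)).
  by rewrite ler_wpM2r ?is_norm_ge0 // ler_norm.
by rewrite ler_piMr.
Qed.

Lemma dual_norm_ge0 (f : dual N) : 0 <= dual_norm N f.
Proof.
apply: le_trans (normr_ge0 (f 0)) _; apply: (ub_le_sup (dual_norm_has_sup f).2).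
by exists 0 => //; rewrite /nball /= is_norm0.
Qed.

Lemma dual_norm_ub (f : dual N) x : `|f x| <= dual_norm N f * N x.
Proof.
have [->|x0] := eqVneq x 0; first by rewrite dual_fun0 normr0 is_norm0 mulr0.
have Nx := is_norm_gt0 x0.
rewrite -ler_pdivrMr //; apply: (ub_le_sup (dual_norm_has_sup f).2).
exists ((N x)^-1 *: x).
  by rewrite /nball /= is_normZ normfV gtr0_norm // mulVf ?gt_eqF.
by rewrite dual_funZ normrM normfV (gtr0_norm Nx) mulrC.
Qed.

Lemma dual_norm_le (f : dual N) (C : R) : 0 <= C -> (forall x, `|f x| <= C * N x) ->
  dual_norm N f <= C.
Proof.
move=> C0 hC; apply: ge_sup; first exact: (dual_norm_has_sup f).1.
by move=> _ [x x1 <-]; apply: le_trans (hC x) _; rewrite ler_piMr.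
Qed.

Lemma dual_norm_gt0 (f : dual N) : f != 0 -> 0 < dual_norm N f.
Proof.
move=> f0; rewrite lt_neqAle dual_norm_ge0 andbT; apply: contra_neq f0 => e.
apply: dual_eq => x; apply/eqP; rewrite dual0 -normr_le0.
by apply: le_trans (dual_norm_ub f x) _; rewrite -e mul0r.
Qed.

Section Gateaux.
Variables (x : V) (f : dual N).
Hypothesis x_neq0 : x != 0.
Hypothesis f_derive :
  forall h : V, t^-1 * (N (x + t *: h) - N x) @[t --> 0^'] --> (f h : R).

(** The one-sided form without division, matching the estimates for the gauge norms. *)
Lemma gateaux_upper (h : V) (e : R) : 0 < e ->
  exists2 d : R, 0 < d & forall tau : R, `|tau| <= d ->
    N (x + tau *: h) <= N x + tau * f h + e * `|tau|.
Proof.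
move=> e0; have := @f_derive h; move=> /cvgrPdist_le /(_ e e0).
rewrite near_withinE => -[d /= d0 hd]; exists (d / 2); first by rewrite divr_gt0.
move=> tau htau; have [->|t0] := eqVneq tau 0.
  by rewrite scale0r addr0 mul0r normr0 mulr0 !addr0.
have dd : `|0 - tau| < d.
  by rewrite sub0r normrN (le_lt_trans htau) // ltr_pdivrMr // ltr_pMr // ltr1n.
have := hd tau dd t0; rewrite /= => h1.
have nt : 0 < `|tau| by rewrite normr_gt0.
have : `|tau * f h - (N (x + tau *: h) - N x)| <= e * `|tau|.
  have -> : tau * f h - (N (x + tau *: h) - N x) =
      tau * (f h - tau^-1 * (N (x + tau *: h) - N x)) by field.
  by rewrite normrM mulrC ler_pM2r.
rewrite ler_norml => /andP[h2 _]; lra.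
Qed.

Lemma gateaux_self : f x = N x :> R.
Proof.
apply/eqP; rewrite eq_le; apply/andP; split; apply/ler_addgt0Pr => e e0.
- have [d d0 /(_ (- Num.min d 1))] := gateaux_upper x e0.
  (* A step of at most 1 keeps [1 - m] nonnegative, so that N at [(1 - m) *: x] is
     [(1 - m) * N x]. *)
  set m := Num.min d 1; have m0 : 0 < m by rewrite lt_min d0 ltr01.
  have m1 : m <= 1 by rewrite ge_min lexx orbT.
  rewrite normrN (gtr0_norm m0) ge_min lexx /= => /(_ isT).
  rewrite -{1}(scale1r x) -scalerDl is_normZ ger0_norm ?subr_ge0 // => h.
  have : m * f x <= m * (N x + e) by lra.
  by rewrite ler_pM2l.
- have [d d0 /(_ d)] := gateaux_upper x e0; rewrite (gtr0_norm d0) lexx => /(_ isT).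
  rewrite -{1}(scale1r x) -scalerDl is_normZ ger0_norm ?addr_ge0 ?(ltW d0) // => h.
  have : d * N x <= d * (f x + e) by lra.
  by rewrite ler_pM2l.
Qed.

Lemma gateaux_bound h : `|f h| <= N h.
Proof.
have bd k : - f k <= N k.
  apply/ler_addgt0Pr => e e0; have [d d0 /(_ d)] := gateaux_upper k e0.
  rewrite (gtr0_norm d0) lexx => /(_ isT) h1.
  have := is_normD (x + d *: k) (- (d *: k)); rewrite addrK is_normN is_normZ (gtr0_norm d0) => h2.
  have : d * (- f k) <= d * (N k + e) by lra.
  by rewrite ler_pM2l.
rewrite ler_norml -lerNl bd /=.
by have := bd (- h); rewrite dual_funN opprK is_normN.
Qed.

Lemma gateaux_NA : NA N f.
Proof.
have Nx := is_norm_gt0 x_neq0.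
have fy : `|f ((N x)^-1 *: x)| = 1.
  by rewrite dual_funZ gateaux_self mulVf ?gt_eqF // normr1.
exists ((N x)^-1 *: x).
  by rewrite /nsphere /= is_normZ normfV gtr0_norm // mulVf ?gt_eqF.
rewrite fy; apply/eqP; rewrite eq_le; apply/andP; split; last first.
  by apply: dual_norm_le => // h; rewrite mul1r gateaux_bound.
rewrite -fy; apply: le_trans (dual_norm_ub f _) _.
by rewrite is_normZ normfV gtr0_norm // mulVf ?gt_eqF // mulr1.
Qed.

End Gateaux.

End NormFacts.

(** * Differentiability of p *)

Lemma l1norm_le (R : realType) (I : choiceType) (b : l1 R I) (r : R) :
  (forall s : seq I, uniq s -> \sum_(i <- s) `|b i| <= r) -> l1norm b <= r.
Proof. by move=> h; rewrite -lee_fin -l1normE; apply: (@esum_le_of_seq R I (fun i => `|b i|)). Qed.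

Lemma l1norm_basis_le (R : realType) (I : choiceType) (i : I) : l1norm (l1_basis R i) <= 1.
Proof.
apply: l1norm_le => s us.
have E k : `|l1_basis R i k| = (k == i)%:R by rewrite /= /kronecker normr_nat.
under eq_bigr do rewrite E.
have [si|si] := boolP (i \in s).
  by rewrite (bigD1_seq i) //= eqxx big1 ?addr0 // => k /negPf ->.
rewrite big1_seq // => k /= sk.
by rewrite (_ : (k == i) = false) //; apply: contraNF si => /eqP <-.
Qed.

Lemma l1_sum (R : realType) (I : choiceType) (J : Type) (s : seq J) (F : J -> l1 R I) q :
  (\sum_(j <- s) F j) q = \sum_(j <- s) (F j q : R) :> R.
Proof. by elim/big_ind2: _ => // a1 c1 a2 c2 <- <-. Qed.

(** * The weights 2^-n and m 2^-m *)

Section Weights.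
Variable R : realType.

Definition half_pow n : R := (2 ^+ n)^-1.
Definition weight m : R := m.+1%:R / 2 ^+ m.+1.

Lemma half_pow_gt0 n : 0 < half_pow n. Proof. by rewrite /half_pow invr_gt0 exprn_gt0. Qed.
Lemma half_powS n : half_pow n.+1 = half_pow n / 2.
Proof. by rewrite /half_pow exprS invfM mulrC. Qed.
Lemma half_pow_le1 n : half_pow n <= 1.
Proof. by rewrite /half_pow invf_le1 ?exprn_gt0 // exprn_ege1 // ler1n. Qed.
Lemma weight_ge0 m : 0 <= weight m. Proof. by rewrite /weight divr_ge0 // exprn_ge0. Qed.
Lemma weightE m : weight m = m.+1%:R * half_pow m.+1. Proof. by []. Qed.

Lemma sum_half_pow n : \sum_(i < n) half_pow i.+1 = 1 - half_pow n.
Proof.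
elim: n => [|n IH]; first by rewrite big_ord0 /half_pow expr0 invr1 subrr.
by rewrite big_ord_recr /= IH half_powS; field.
Qed.

Lemma sum_weight n : \sum_(i < n) weight i = 2 - (n%:R + 2) * half_pow n.
Proof.
elim: n => [|n IH]; first by rewrite big_ord0 /half_pow expr0 invr1 mulr1 add0r subrr.
by rewrite big_ord_recr /= IH weightE half_powS -natr1; field.
Qed.

Lemma sum_weight_le2 n : \sum_(i < n) weight i <= 2.
Proof. by rewrite sum_weight gerBl mulr_ge0 ?addr_ge0 // ltW // half_pow_gt0. Qed.

Lemma half_pow_tail n k :
  \sum_(i < n) (if (i < k)%N then 0 else half_pow i.+1) <= half_pow k.
Proof.
apply: (@sum_ord_le_eventually R (fun i => if (i < k)%N then 0 else half_pow i.+1) k).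
  by move=> i; case: ifP => // _; rewrite ltW // half_pow_gt0.
move=> {}n kn; have := sum_half_pow n.
rewrite (eq_bigr (fun i : 'I_n => (if (i < k)%N then half_pow i.+1 else 0) +
  (if (i < k)%N then 0 else half_pow i.+1))); last first.
  by move=> i _; case: ifP; rewrite ?addr0 ?add0r.
rewrite big_split /= (sum_ord_cut (fun i => half_pow i.+1) kn) sum_half_pow => e.
have := half_pow_gt0 n; lra.
Qed.

Lemma half_pow_lt (e : R) : 0 < e -> exists k0, forall k, (k0 <= k)%N -> half_pow k < e.
Proof.
move=> e0; exists (Num.truncn e^-1).+1 => k hk.
rewrite /half_pow -[ltRHS]invrK ltf_pV2 ?posrE ?exprn_gt0 ?invr_gt0 //.
apply: lt_le_trans (truncnS_gt _) _.
apply: le_trans (_ : k%:R <= _); first by rewrite ler_nat.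
by rewrite -natrX ler_nat ltnW // ltn_expl.
Qed.

(** At k = 2 j the quantity is at most [4 * half_pow j], because j + 1 <= 2^j. The summand 4 comes
    from [weighted_l1], where two tails add up. *)
Lemma weight_tail_lt (e : R) : 0 < e -> exists k, (k%:R + 4) * half_pow k < e.
Proof.
move=> e0; have [j hj] := half_pow_lt (divr_gt0 e0 (ltr0n R 4)).
exists (j + j)%N; have h1 := hj j (leqnn j).
have -> : half_pow (j + j) = half_pow j * half_pow j by rewrite /half_pow exprD invfM.
have h2 : (j.+1)%:R * half_pow j <= 1.
  by rewrite /half_pow ler_pdivrMr ?exprn_gt0 // mul1r -natrX ler_nat ltn_expl.
have h0 := half_pow_gt0 j.
have h3 : (j + j)%:R + 4 <= 4 * (j.+1)%:R :> R.
  have -> : j.+1%:R = j%:R + 1 :> R by rewrite natr1.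
  by have := ler0n R j; rewrite natrD; lra.
have h4 : ((j + j)%:R + 4) * (half_pow j * half_pow j) <= 4 * (j.+1)%:R * (half_pow j * half_pow j).
  by rewrite ler_pM2r // mulr_gt0.
apply: le_lt_trans h4 _.
have -> : 4 * j.+1%:R * (half_pow j * half_pow j) = 4 * ((j.+1%:R * half_pow j) * half_pow j) by ring.
have : (j.+1)%:R * half_pow j * half_pow j <= half_pow j by rewrite ler_piMl // ltW.
lra.
Qed.

End Weights.

(** * Convergence and homogeneity of p *)

Section PNorm.
Context {R : realType}.
Variables (N : c0 R -> R) (T : {linear l1 R (nat * nat)%type -> dual N}) (C : R).
Hypothesis N_norm : is_norm N.
Hypothesis T_inj : injective T.
Hypothesis C_gt0 : 0 < C.
Hypothesis T_bd : forall a, dual_norm N (T a) <= C * l1norm a.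

Local Notation v := (vstar T).
Local Notation hp := (@half_pow R).
Local Notation wt := (@weight R).

Lemma vstar_norm_le n m : dual_norm N (v n m) <= C.
Proof.
apply: le_trans (T_bd _) _; rewrite ler_piMr ?(ltW C_gt0) //.
exact: l1norm_basis_le.
Qed.

Lemma vstar_norm_gt0 n m : 0 < dual_norm N (v n m).
Proof.
apply: dual_norm_gt0 => //; apply/eqP => e.
have : l1_basis R (n, m) = 0 by apply: T_inj; rewrite raddf0.
move/(congr1 (fun a : l1 R (nat * nat)%type => a (n, m))).
by rewrite /= /kronecker eqxx => /eqP; rewrite oner_eq0.
Qed.

Lemma vstar_le n m x : `|v n m x| <= C * N x.
Proof.
apply: le_trans (dual_norm_ub N_norm _ _) _; rewrite ler_wpM2r ?is_norm_ge0 //.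
exact: vstar_norm_le.
Qed.

Lemma R_opE m x n : R_op T m x n = wt m * hp n.+1 * v n m x. Proof. by []. Qed.
Lemma PhiE m n : Phi T m n = hp m.+1 * hp n.+1 * dual_norm N (v n m). Proof. by []. Qed.

Lemma R_opD m x (a : R) y n : R_op T m (x + a *: y) n = R_op T m x n + a * R_op T m y n :> R.
Proof. by rewrite !R_opE dual_funD dual_funZ; ring. Qed.

Lemma Phi_gt0 m n : 0 < Phi T m n.
Proof. by rewrite PhiE !mulr_gt0 ?half_pow_gt0 ?vstar_norm_gt0. Qed.

(** The bound tends to 0 as m grows. Through [gradient_saturated] this is what brings the gradient
    of the m-th gauge norm close to a sign. *)
Lemma sum_Phi_sqr m n : \sum_(i < n) Phi T m i ^+ 2 <= (C * hp m.+1) ^+ 2.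
Proof.
apply: (@le_trans _ _ (\sum_(i < n) (C * hp m.+1) ^+ 2 * hp i.+1)).
  apply: ler_sum => i _; rewrite PhiE.
  have h1 := half_pow_gt0 R i.+1; have h2 := half_pow_le1 R i.+1.
  have h3 := half_pow_gt0 R m.+1; have h4 := vstar_norm_le i m; have h5 := vstar_norm_gt0 i m.
  have -> : hp m.+1 * hp i.+1 * dual_norm N (v i m) =
            (dual_norm N (v i m) * hp m.+1) * hp i.+1 by ring.
  rewrite exprMn; apply: ler_pM; rewrite ?sqr_ge0 //.
    rewrite ler_sqr ?nnegrE ?mulr_ge0 ?(ltW C_gt0) ?(ltW h3) ?(ltW h5) //.
    by rewrite ler_pM2r.
  by rewrite expr2 ler_piMr // ltW.
rewrite -mulr_sumr sum_half_pow ler_piMr ?sqr_ge0 //.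
by rewrite gerBl ltW // half_pow_gt0.
Qed.

Let CN_ge0 x : 0 <= C * N x.
Proof. by rewrite mulr_ge0 ?is_norm_ge0 // ltW. Qed.

Lemma R_op_abs m x n : `|R_op T m x n| <= wt m * (C * N x) * hp n.+1.
Proof.
rewrite R_opE normrM ger0_norm; last by rewrite mulr_ge0 ?weight_ge0 // ltW // half_pow_gt0.
rewrite mulrAC; apply: ler_wpM2r; first by rewrite ltW // half_pow_gt0.
by apply: ler_wpM2l; [exact: weight_ge0|exact: vstar_le].
Qed.

Lemma sum_R_op_tail m x k n :
  \sum_(i < n) (if (i < k)%N then 0 else `|R_op T m x i|) <= wt m * (C * N x) * hp k.
Proof.
have w0 : 0 <= wt m * (C * N x) by rewrite mulr_ge0 ?weight_ge0.
apply: (@le_trans _ _ (\sum_(i < n) wt m * (C * N x) * (if (i < k)%N then 0 else hp i.+1))).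
  by apply: ler_sum => i _; case: ifP => _; rewrite ?mulr0 // R_op_abs.
by rewrite -mulr_sumr ler_wpM2l // half_pow_tail.
Qed.

Lemma sum_R_op m x n : \sum_(i < n) `|R_op T m x i| <= wt m * (C * N x).
Proof. by have := sum_R_op_tail m x 0 n; rewrite /half_pow expr0 invr1 mulr1. Qed.

Definition p_term x m : R := gauge_norm (Phi T m) (R_op T m x).

Lemma p_term_ge0 x m : 0 <= p_term x m. Proof. exact: gauge_norm_ge0. Qed.

Lemma p_term_le x m : p_term x m <= wt m * (C * N x).
Proof. by apply: gauge_norm_le_l1 => n; exact: sum_R_op. Qed.

Lemma sum_p_term_le x n : \sum_(m < n) p_term x m <= 2 * (C * N x).
Proof.
apply: (@le_trans _ _ (\sum_(m < n) wt m * (C * N x))).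
  by apply: ler_sum => m _; exact: p_term_le.
by rewrite -mulr_suml ler_wpM2r // sum_weight_le2.
Qed.

Lemma p_term_cvg x : cvgn (series (p_term x)).
Proof. by apply: bounded_series_cvg (sum_p_term_le x); exact: p_term_ge0. Qed.

Lemma p_normE x : p_norm T x = N x + limn (series (p_term x)). Proof. by []. Qed.

Lemma le_p_norm x : N x <= p_norm T x.
Proof.
rewrite p_normE lerDl.
have := sum_le_lim_series 0 (p_term_ge0 x) (@p_term_cvg x).
by rewrite big_ord0.
Qed.

Lemma p_norm_ge0 x : 0 <= p_norm T x.
Proof. exact: le_trans (is_norm_ge0 N_norm x) (le_p_norm x). Qed.

Lemma p_norm0 : p_norm T 0 = 0.
Proof.
rewrite p_normE is_norm0 // add0r.
apply/eqP; rewrite eq_le; apply/andP; split.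
  apply: lim_series_le_bound; first exact: p_term_cvg.
  by move=> n; apply: le_trans (sum_p_term_le 0 n) _; rewrite is_norm0 // !mulr0.
by have := sum_le_lim_series 0 (p_term_ge0 0) (@p_term_cvg 0); rewrite big_ord0.
Qed.

Lemma p_norm_eq0 x : p_norm T x = 0 -> x = 0.
Proof.
move=> e; apply: (is_norm_eq0 N_norm); apply/eqP; rewrite eq_le is_norm_ge0 // andbT.
by rewrite -e le_p_norm.
Qed.

Lemma p_normZ_le (a : R) x : a != 0 -> p_norm T (a *: x) <= `|a| * p_norm T x.
Proof.
move=> a0; rewrite !p_normE is_normZ // mulrDr lerD2l.
apply: lim_series_le_bound; first exact: p_term_cvg.
move=> n; apply: (@le_trans _ _ (`|a| * \sum_(m < n) p_term x m)); last first.
  by rewrite ler_wpM2l // sum_le_lim_series //; [exact: p_term_ge0|exact: p_term_cvg].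
rewrite mulr_sumr; apply: ler_sum => m _; rewrite /p_term.
have -> : R_op T m (a *: x) = a *: R_op T m x.
  apply/funext => i; rewrite !fctE R_opE dual_funZ.
  by rewrite /GRing.scale /= R_opE; ring.
by apply: gauge_normZ_le a0 => k; exact: sum_R_op.
Qed.

Lemma p_normZ (a : R) x : p_norm T (a *: x) = `|a| * p_norm T x.
Proof.
have [->|a0] := eqVneq a 0; first by rewrite scale0r p_norm0 normr0 mul0r.
apply/eqP; rewrite eq_le p_normZ_le //=.
have := p_normZ_le (a *: x) (invr_neq0 a0).
by rewrite scalerA mulVf // scale1r normfV ler_pdivlMl // normr_gt0.
Qed.

End PNorm.

Lemma sum_ord_split (R : realType) (f : nat -> R) k n : (k <= n)%N ->
  \sum_(i < n) f i = \sum_(i < k) f i + \sum_(i < n) (if (i < k)%N then 0 else f i).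
Proof.
move=> kn; rewrite -(sum_ord_cut f kn) -big_split /=; apply: eq_bigr => i _.
by case: ifP; rewrite ?addr0 ?add0r.
Qed.

Lemma weight_tail (R : realType) n k : (k <= n)%N ->
  \sum_(i < n) (if (i < k)%N then 0 else weight R i) <= (k%:R + 2) * half_pow R k.
Proof.
move=> kn; have := sum_ord_split (weight R) kn; rewrite !sum_weight => e.
have : 0 <= (n%:R + 2) * half_pow R n by rewrite mulr_ge0 ?addr_ge0 // ltW // half_pow_gt0.
lra.
Qed.

(** * Gradients of the terms of p *)

Section PDerivative.
Context {R : realType}.
Variables (N : c0 R -> R) (T : {linear l1 R (nat * nat)%type -> dual N}) (C : R).
Hypothesis N_norm : is_norm N.
Hypothesis T_inj : injective T.
Hypothesis C_gt0 : 0 < C.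
Hypothesis T_bd : forall a, dual_norm N (T a) <= C * l1norm a.

Local Notation v := (vstar T).
Local Notation hp := (@half_pow R).
Local Notation wt := (@weight R).

(** The gradients of all the terms become one element of l_1(N x N), to which T applies. Cutting it
    to a k by k square has two costs: at most [(k + 2) * half_pow k] for the strip m >= k, and at
    most [2 * half_pow k] for the strip n >= k. *)
Lemma weighted_l1 (g : nat -> nat -> R) : (forall m n, `|g m n| <= 1) ->
  exists a : l1 R (nat * nat)%type,
    (forall n m, a (n, m) = wt m * hp n.+1 * g m n :> R) /\
    forall k, l1norm (a - \sum_(m < k) \sum_(n < k) (a (n : nat, m : nat) : R) *: l1_basis R (n : nat, m : nat))
      <= (k%:R + 4) * hp k.
Proof.
move=> g1; pose f (p : nat * nat) : R := wt p.2 * hp p.1.+1 * g p.2 p.1.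
have fle p : `|f p| <= wt p.2 * hp p.1.+1.
  have wh : 0 <= wt p.2 * hp p.1.+1 by rewrite mulr_ge0 ?weight_ge0 // ltW // half_pow_gt0.
  by rewrite /f normrM (ger0_norm wh) ler_piMr.
have sumW K : \sum_(i < K) \sum_(j < K) wt j * hp i.+1 = (\sum_(j < K) wt j) * (1 - hp K).
  rewrite -sum_half_pow mulr_sumr; apply: eq_bigr => i _; by rewrite mulr_suml.
have [a aE _] : exists2 a : l1 R (nat * nat)%type, l1_fun a = f & l1norm a <= 2.
  apply: l1_ofP; apply: (@sum_seq_nat2_le _ (fun p => `|f p|)) => // K.
  apply: (@le_trans _ _ (\sum_(i < K) \sum_(j < K) wt j * hp i.+1)).
    by apply: ler_sum => i _; apply: ler_sum => j _; exact: fle.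
  rewrite sumW; have := sum_weight_le2 R K; have := half_pow_gt0 R K; have := half_pow_le1 R K.
  have : 0 <= \sum_(j < K) wt j by apply: sumr_ge0 => j _; exact: weight_ge0.
  nra.
exists a; split=> [n m|k]; first by rewrite aE.
set b := \sum_(m < k) _.
have bE p : b p = (if (p.1 < k)%N && (p.2 < k)%N then f p else 0) :> R.
  case: p => n m /=; rewrite /b l1_sum.
  under eq_bigr do rewrite l1_sum.
  transitivity (\sum_(m' < k) \sum_(n' < k)
     (if n' == n :> nat then (if m' == m :> nat then f (n, m) else 0) else 0)).
    apply: eq_bigr => m' _; apply: eq_bigr => n' _.
    rewrite -[LHS]/(a (n' : nat, m' : nat) * ((n, m) == (n' : nat, m' : nat))%:R) aE xpair_eqE.
    rewrite (eq_sym n) (eq_sym m); have [->|_] := eqVneq (n' : nat) n; last by rewrite mulr0.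
    by have [->|_] := eqVneq (m' : nat) m; rewrite ?mulr1 ?mulr0.
  have zero j (F : nat -> R) : (k <= j)%N -> \sum_(i < k) (if i == j :> nat then F i else 0) = 0.
    by move=> kj; rewrite big1 // => i _; rewrite ltn_eqF // (leq_trans (ltn_ord i)).
  have [nk|kn] := ltnP n k; last first.
    by rewrite big1 // => m' _; rewrite (zero n (fun=> if m' == m :> nat then f (n, m) else 0)).
  under eq_bigr do rewrite sum_ord_delta //.
  have [mk|km] := ltnP m k; first by rewrite sum_ord_delta.
  by rewrite (zero m (fun=> f (n, m))).
apply: l1norm_le; apply: (@sum_seq_nat2_le R (fun p => `|(a - b) p|)) => [//|K].
pose w i j : R := if (i < k)%N && (j < k)%N then 0 else wt j * hp i.+1.
apply: (@le_trans _ _ (\sum_(i < K) \sum_(j < K) w i j)).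
  apply: ler_sum => i _; apply: ler_sum => j _.
  rewrite -[X in `|X|]/(a (i : nat, j : nat) - b (i : nat, j : nat)) bE aE /w /=.
  by case: ifP => _; rewrite ?subrr ?normr0 ?subr0 // (fle (i : nat, j : nat)).
have w0 i j : 0 <= w i j.
  by rewrite /w; case: ifP => // _; rewrite mulr_ge0 ?weight_ge0 // ltW // half_pow_gt0.
have wle i j : w i j <= (if (i < k)%N then 0 else hp i.+1) * wt j +
    (if (j < k)%N then 0 else wt j) * hp i.+1.
  have h0 := half_pow_gt0 R i.+1; have q0 := weight_ge0 R j.
  rewrite /w; case: ltnP => _; case: ltnP => _ /=; rewrite ?mul0r ?add0r ?addr0 //.
  - by rewrite mulrC.
  - by rewrite mulrC lerDr mulr_ge0 // ltW.
pose M := maxn K k.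
(* [weight_tail] concerns ranges of length at least k, hence the enlargement from K to M. *)
have KM : \sum_(i < K) \sum_(j < K) w i j <= \sum_(i < M) \sum_(j < M) w i j.
  apply: (@le_trans _ _ (\sum_(i < K) \sum_(j < M) w i j)).
    by apply: ler_sum => i _; apply: sum_ord_le_mono => //; exact: leq_maxl.
  apply: (@sum_ord_le_mono R (fun i => \sum_(j < M) w i j)); last exact: leq_maxl.
  by move=> i; apply: sumr_ge0.
apply: le_trans KM _.
apply: (@le_trans _ _ (\sum_(i < M) \sum_(j < M) ((if (i < k)%N then 0 else hp i.+1) * wt j +
    (if (j < k)%N then 0 else wt j) * hp i.+1))).
  by apply: ler_sum => i _; apply: ler_sum => j _; exact: wle.
under eq_bigr do rewrite big_split /= -mulr_sumr -mulr_suml.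
rewrite big_split /= -mulr_suml -mulr_sumr sum_half_pow.
have h1 := half_pow_tail R M k; have h2 := sum_weight_le2 R M.
have h3 := @weight_tail R M k (leq_maxr _ _).
have h4 : 0 <= \sum_(i < M) wt i by apply: sumr_ge0 => i _; exact: weight_ge0.
have h5 := half_pow_gt0 R M; have h6 := half_pow_gt0 R k.
have h7 : 0 <= \sum_(j < M) (if (j < k)%N then 0 else wt j).
  by apply: sumr_ge0 => i _; case: ifP => // _; exact: weight_ge0.
set A := \sum_(i < M) (if (i < k)%N then 0 else hp i.+1) in h1 *.
set B := \sum_(i < M) (if (i < k)%N then 0 else wt i) in h3 h7 *.
set D := \sum_(i < M) wt i in h2 h4 *.
have : A * D <= hp k * 2.
  apply: le_trans (_ : hp k * D <= _); first by rewrite ler_wpM2r.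
  by rewrite ler_wpM2l // ltW.
have : B * (1 - hp M) <= B by rewrite ler_piMr // gerBl ltW.
lra.
Qed.

Variable x : c0 R.
Hypothesis v_sep : forall m, exists n, v n m x != 0.

Lemma p_gradients : exists g : nat -> nat -> R,
  [/\ forall m n, `|g m n| <= 1,
      forall m n, C * N x * hp m.+1 < `|v n m x| / dual_norm N (v n m) ->
        exists2 G : R, 1 - C * hp m.+1 <= G <= 1 & g m n = Num.sg (v n m x : R) * G,
      forall h (tau : R) m, p_term T (x + tau *: h) m <= p_term T x m + `|tau| * (wt m * (C * N h))
    & forall h k m, exists D d : R, [/\ 0 <= D, 0 < d & forall tau : R, `|tau| <= d ->
        p_term T (x + tau *: h) m <= p_term T x m +
          tau * (\sum_(j < k) g m j * R_op T m h j) + `|tau| * (wt m * (C * N h) * hp k) + D * tau ^+ 2]].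
Proof.
have term_eq h (tau : R) m : p_term T (x + tau *: h) m =
    gauge_norm (Phi T m) (fun i => (R_op T m x i : R) + tau * (R_op T m h i : R)).
  by rewrite /p_term; congr gauge_norm; apply/funext => i; exact: R_opD.
have gm m : exists g : nat -> R, [/\ forall n, `|g n| <= 1,
     forall n, C * N x * hp m.+1 < `|v n m x| / dual_norm N (v n m) ->
        exists2 G : R, 1 - C * hp m.+1 <= G <= 1 & g n = Num.sg (v n m x : R) * G,
      forall h (tau : R), p_term T (x + tau *: h) m <= p_term T x m + `|tau| * (wt m * (C * N h))
    & forall h k, exists D d : R, [/\ 0 <= D, 0 < d & forall tau : R, `|tau| <= d ->
        p_term T (x + tau *: h) m <= p_term T x m +
          tau * (\sum_(j < k) g j * R_op T m h j) + `|tau| * (wt m * (C * N h) * hp k) + D * tau ^+ 2]].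
  have [j0 vj0] := v_sep m.
  have P0 := @Phi_gt0 R N T N_norm T_inj m.
  have hm := half_pow_gt0 R m.+1.
  have s0 : 0 <= C * hp m.+1 by rewrite mulr_ge0 // ltW.
  have zj0 : R_op T m x j0 != 0.
    have w0 : 0 < wt m by rewrite /weight divr_gt0 ?exprn_gt0.
    by rewrite R_opE mulf_neq0 // gt_eqF // mulr_gt0 ?half_pow_gt0.
  have [g [g1 g2 g3 g4]] := exists_gradient P0 s0 (sum_Phi_sqr N_norm T_inj C_gt0 T_bd m)
    (sum_R_op N_norm C_gt0 T_bd m x) zj0.
  exists g; split=> //.
  - move=> n hn; have hn1 := half_pow_gt0 R n.+1; have dn := vstar_norm_gt0 N_norm T_inj n m.
    have wh : 0 < wt m * hp n.+1 by rewrite mulr_gt0 // divr_gt0 // exprn_gt0.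
    have [|G hG ->] := g2 n.
      (* Both the quotient of [R_op] by [Phi] and the l_1 bound on [R_op] carry the factor m + 1.
         After cancellation the saturation threshold is [C * N x * half_pow m.+1], which tends to
         0. *)
      rewrite R_opE PhiE normrM (gtr0_norm wh).
      have -> : wt m * hp n.+1 * `|v n m x| / (hp m.+1 * hp n.+1 * dual_norm N (v n m)) =
         m.+1%:R * (`|v n m x| / dual_norm N (v n m)).
        by rewrite weightE; field; rewrite !gt_eqF.
      rewrite weightE -mulrA ltr_pM2l ?ltr0n // mulrC //.
    exists G => //; rewrite R_opE sgrM (gtr0_sg wh) mul1r //.
  - move=> h tau; rewrite term_eq; apply: g3; exact: sum_R_op.
  - move=> h k; have [D [d [D0 d0 hd]]] := g4 (R_op T m h) k _ (sum_R_op_tail N_norm C_gt0 T_bd m h k).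
    by exists D, d; split=> // tau htau; rewrite term_eq; exact: hd.
have [g hg] := choice gm; exists g; split.
- by move=> m; case: (hg m).
- by move=> m; case: (hg m).
- by move=> h tau m; case: (hg m).
- by move=> h k m; case: (hg m).
Qed.

End PDerivative.

(** * One-sided differentiability of the series in p *)

Section PUpper.
Context {R : realType}.
Variables (N : c0 R -> R) (T : {linear l1 R (nat * nat)%type -> dual N}) (C : R).
Hypothesis N_norm : is_norm N.
Hypothesis T_inj : injective T.
Hypothesis C_gt0 : 0 < C.
Hypothesis T_bd : forall a, dual_norm N (T a) <= C * l1norm a.

Local Notation v := (vstar T).
Local Notation hp := (@half_pow R).
Local Notation wt := (@weight R).

Variable x : c0 R.
Hypothesis v_sep : forall m, exists n, v n m x != 0.

(** The first k terms are treated by their gradients; the others cost at most [|tau|] times a tail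
    of the weights. The allowance e is split in thirds: the quadratic remainder, the truncation of
    a, and the tails. *)
Lemma p_upper_derivative : exists (g : nat -> nat -> R) (a : l1 R (nat * nat)%type),
  [/\ forall n m, a (n, m) = wt m * hp n.+1 * g m n :> R,
      forall m n, C * N x * hp m.+1 < `|v n m x| / dual_norm N (v n m) ->
        exists2 G : R, 1 - C * hp m.+1 <= G <= 1 & g m n = Num.sg (v n m x : R) * G
    & forall (h : c0 R) (e : R), 0 < e -> exists2 d : R, 0 < d & forall tau : R, `|tau| <= d ->
        limn (series (p_term T (x + tau *: h))) <=
        limn (series (p_term T x)) + tau * (T a h : R) + e * `|tau|].
Proof.
have [g [g1 g2 g3 g4]] := p_gradients N_norm T_inj C_gt0 T_bd v_sep.
have [a [aE a_tail]] := weighted_l1 g1.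
exists g, a; split=> // h e e0.
have CN0 : 0 <= C * N h by rewrite mulr_ge0 ?is_norm_ge0 // ltW.
have [k hk] : exists k, (k%:R + 4) * hp k * (C * N h) <= e / 3.
  have [|k hk] := @weight_tail_lt R (e / 3 / (C * N h + 1)).
    by rewrite !divr_gt0 // ltr_wpDl.
  exists k; move: hk; rewrite ltr_pdivlMr; last by rewrite ltr_wpDl.
  have : 0 <= (k%:R + 4) * hp k by rewrite mulr_ge0 ?addr_ge0 // ltW // half_pow_gt0.
  lra.
set E := (k%:R + 4) * hp k in hk a_tail.
pose c m : R := \sum_(j < k) g m j * (R_op T m h j : R).
(* The range d and the constant D depend on the term, so they are combined over finitely many terms
   only. *)
have fin K : exists D d : R, [/\ 0 <= D, 0 < d & forall tau : R, `|tau| <= d ->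
    \sum_(m < K) p_term T (x + tau *: h) m <= \sum_(m < K) p_term T x m +
      tau * (\sum_(m < K) c m) + `|tau| * ((\sum_(m < K) wt m) * (C * N h) * hp k) + D * tau ^+ 2].
  elim: K => [|K [D [d [D0 d0 hd]]]].
    exists 0, 1; split=> // tau _; rewrite !big_ord0; lra.
  have [D' [d' [D'0 d'0 hd']]] := g4 h k K.
  exists (D + D'), (Num.min d d'); split; [exact: addr_ge0|by rewrite lt_min d0|].
  move=> tau; rewrite le_min => /andP[t1 t2].
  have := hd tau t1; have := hd' tau t2; rewrite !big_ord_recr /= -/(c K).
  nra.
have [D [d [D0 d0 hd]]] := fin k.
have Tc : `|(T a h : R) - \sum_(m < k) c m| <= E * (C * N h).
  set b := (\sum_(m < k) \sum_(n < k) (a (n : nat, m : nat) : R) *: l1_basis R (n : nat, m : nat)).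
  have Tb : T b h = \sum_(m < k) c m :> R.
    rewrite /b linear_sum dual_sum; apply: eq_bigr => m _.
    rewrite linear_sum dual_sum; apply: eq_bigr => n _.
    by rewrite linearZ dualZ aE R_opE; ring.
  rewrite -Tb -[X in `|X|]/((T a - T b) h) -linearB.
  apply: le_trans (dual_norm_ub N_norm _ _) _.
  apply: (@le_trans _ _ (C * l1norm (a - b) * N h)).
    by rewrite ler_wpM2r ?is_norm_ge0.
  have -> : C * l1norm (a - b) * N h = l1norm (a - b) * (C * N h) by ring.
  by rewrite ler_wpM2r // a_tail.
pose d1 : R := Num.min d (e / 3 / (D + 1)).
have D1 : 0 < D + 1 by rewrite ltr_wpDl.
exists d1; first by rewrite lt_min d0 !divr_gt0.
move=> tau; rewrite le_min => /andP[t1 t2].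
have t3 : D * tau ^+ 2 <= e / 3 * `|tau|.
  rewrite -(real_normK (num_real tau)) expr2 mulrA ler_wpM2r //.
  move: t2; rewrite ler_pdivlMr //; have := normr_ge0 tau; lra.
have t4 : tau * (\sum_(m < k) c m) <= tau * (T a h : R) + `|tau| * (E * (C * N h)).
  rewrite -lerBlDl -mulrBr; apply: le_trans (ler_norm _) _.
  by rewrite normrM distrC ler_wpM2l.
have t5 : `|tau| * (E * (C * N h)) <= `|tau| * (e / 3) by rewrite ler_wpM2l.
set L := limn (series (p_term T x)).
suff main : forall n, \sum_(m < n) p_term T (x + tau *: h) m <=
    L + tau * (\sum_(m < k) c m) + `|tau| * (E * (C * N h)) + D * tau ^+ 2.
  have cv : cvgn (series (p_term T (x + tau *: h))) by apply: (p_term_cvg N_norm C_gt0 T_bd).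
  have := lim_series_le_bound cv main; lra.
apply: (@sum_ord_le_eventually R (p_term T (x + tau *: h)) k) => [m|n kn].
  exact: p_term_ge0.
rewrite (sum_ord_split (p_term T (x + tau *: h)) kn).
apply: (@le_trans _ _ (\sum_(m < k) p_term T (x + tau *: h) m +
   \sum_(m < n) (if (m < k)%N then 0 else p_term T x m + `|tau| * (wt m * (C * N h))))).
  by rewrite lerD2l; apply: ler_sum => m _; case: ifP => // _; exact: g3.
have -> : \sum_(m < n) (if (m < k)%N then 0 else p_term T x m + `|tau| * (wt m * (C * N h))) =
   \sum_(m < n) (if (m < k)%N then 0 else p_term T x m) +
   `|tau| * ((\sum_(m < n) (if (m < k)%N then 0 else wt m)) * (C * N h)).
  rewrite mulr_suml mulr_sumr -big_split /=; apply: eq_bigr => m _.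
  by case: ifP; rewrite ?mul0r ?mulr0 ?addr0.
have s1 := hd tau t1.
have s2 : \sum_(m < k) p_term T x m + \sum_(m < n) (if (m < k)%N then 0 else p_term T x m) <= L.
  rewrite -(sum_ord_split (p_term T x) kn); apply: sum_le_lim_series.
    exact: p_term_ge0.
  by apply: (p_term_cvg N_norm C_gt0 T_bd).
(* Up to the common factor, the coordinate tails in the first k terms add up to at most [2 * hp k]
   and the remaining weights to at most [(k + 2) * hp k]; together this is E. *)
have s3 : `|tau| * ((\sum_(m < k) wt m) * (C * N h) * hp k) +
    `|tau| * ((\sum_(m < n) (if (m < k)%N then 0 else wt m)) * (C * N h)) <= `|tau| * (E * (C * N h)).
  rewrite -mulrDr ler_wpM2l // mulrAC -mulrDl ler_wpM2r //.
  have := @weight_tail R n k kn; have := sum_weight_le2 R k; have := half_pow_gt0 R k.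
  rewrite /E => q0 q1 q2.
  have := ler_wpM2r (ltW q0) q1; lra.
lra.
Qed.

End PUpper.

(** * Norm-attaining functionals on c_0 *)

Section C0.
Context {R : realType}.
Implicit Types x y h : c0 R.

Lemma c0_cvg x : (x n : R) @[n --> \oo] --> (0 : R).
Proof. by case: x => u /= /asboolP. Qed.

Lemma mk_c0 (u : nat -> R) k : (forall n, (k <= n)%N -> u n = 0) ->
  exists x : c0 R, forall n, x n = u n :> R.
Proof.
move=> u0; have pu : (u : nat -> R^o) \in @c0_pred R.
  apply/asboolP/cvgrPdist_le => e e0; exists k => // n /= kn.
  by rewrite u0 // subr0 normr0 ltW.
by exists (C0 pu).
Qed.

Lemma c0Z (a : R) x n : (a *: x) n = a * x n :> R. Proof. by []. Qed.
Lemma c0_eq x y : (forall n, x n = y n) -> x = y.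
Proof. by move=> e; apply: val_inj; apply/funext. Qed.
Lemma c0_sum (I : Type) (s : seq I) (F : I -> c0 R) n :
  (\sum_(i <- s) F i) n = \sum_(i <- s) (F i n : R) :> R.
Proof. by elim/big_ind2: _ => // f a g b <- <-. Qed.

Lemma supnorm_has_sup x : has_sup [set `|x n| | n in [set: nat]].
Proof.
split; first by exists `|x 0%N|, 0%N.
have /cvgrPdist_le /(_ 1 ltr01) [k _ hk] := @c0_cvg x.
exists (\sum_(i < k) `|x i| + 1) => _ [n _ <-].
have [nk|kn] := ltnP n k.
  by rewrite (bigD1 (Ordinal nk)) //= -addrA lerDl addr_ge0 // sumr_ge0.
have := hk n kn; rewrite /= sub0r normrN => h.
by rewrite (le_trans h) // lerDr sumr_ge0.
Qed.

Lemma le_supnorm x n : `|x n| <= supnorm x.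
Proof. by apply: (ub_le_sup (supnorm_has_sup x).2); exists n. Qed.

Lemma supnorm_le x (r : R) : (forall n, `|x n| <= r) -> supnorm x <= r.
Proof. by move=> h; apply: ge_sup (supnorm_has_sup x).1 _ => _ [n _ <-]. Qed.

Lemma supnorm_is_norm : is_norm (@supnorm R).
Proof.
split=> [x y|a x|x x0].
- apply: supnorm_le => n; apply: le_trans (ler_normD (x n : R) (y n : R)) _.
  by rewrite lerD // le_supnorm.
- have le1 (b : R) z : supnorm (b *: z) <= `|b| * supnorm z.
    by apply: supnorm_le => n; rewrite normrM ler_wpM2l // le_supnorm.
  have [->|a0] := eqVneq a 0.
    rewrite scale0r normr0 mul0r; apply/eqP; rewrite eq_le.
    rewrite (le_trans _ (le_supnorm 0 0)) // andbT; apply: supnorm_le => n.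
    by rewrite normr0.
  apply/eqP; rewrite eq_le le1 /=.
  have := le1 a^-1 (a *: x); rewrite scalerA mulVf // scale1r normfV.
  by rewrite ler_pdivlMl // normr_gt0.
- by apply: c0_eq => n; apply/eqP; rewrite -normr_le0 -x0 le_supnorm.
Qed.

Let sn := supnorm_is_norm.

(** From some k on, the norming vector x has entries of modulus at most 1/2, so small perturbations
    there stay in the unit ball. As [|f x|] is maximal on the ball, comparing with x + t h and x - t
    h gives f h = 0. *)
Lemma NA_supnorm_tail (f : dual (@supnorm R)) : NA (@supnorm R) f ->
  exists k, forall h, (forall n, (n < k)%N -> h n = 0) -> f h = 0 :> R.
Proof.
move=> [x x1 fx]; have h2 : (0 : R) < 1 / 2 by lra.
have /cvgrPdist_le /(_ _ h2) [k _ hk] := @c0_cvg x.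
exists k => h h0.
pose s : R := supnorm h + 1; have s0 : 0 < s by rewrite ltr_wpDl // (is_norm_ge0 sn).
have key (t : R) : `|t| <= 1 / 2 / s -> `|(f x : R) + t * (f h : R)| <= `|(f x : R)|.
  move=> ht; rewrite -dual_funZ -dual_funD fx; apply: le_trans (dual_norm_ub sn f _) _.
  rewrite ler_piMr ?dual_norm_ge0 //; apply: supnorm_le => n.
  have [nk|kn] := ltnP n k.
    have -> : (x + t *: h) n = x n by rewrite -[LHS]/((x n : R) + t * h n) h0 // mulr0 addr0.
    by move: x1; rewrite /nsphere /= => <-; exact: le_supnorm.
  have := hk n kn; rewrite /= sub0r normrN => xn.
  apply: le_trans (ler_normD (x n : R) (t * h n : R)) _.
  have hn : `|t * h n| <= 1 / 2.
    rewrite normrM; apply: le_trans (_ : `|t| * s <= _); last by rewrite -ler_pdivlMr.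
    rewrite ler_wpM2l //; apply: le_trans (le_supnorm h n) _.
    by rewrite lerDl.
  lra.
pose t : R := 1 / 2 / s; have t0 : 0 < t by rewrite !divr_gt0.
have k1 := key t; have k2 := key (- t).
rewrite normrN (gtr0_norm t0) lexx in k1 k2.
have {}k1 := k1 isT; have {}k2 := k2 isT.
have : t * (f h : R) = 0.
  rewrite mulNr in k2; move: k1 k2; set a : R := f x; set b := t * _.
  case: (leP 0 a) => a0; [rewrite (ger0_norm a0)|rewrite (ltr0_norm a0)];
    by rewrite !ler_norml => /andP[? ?] /andP[? ?]; lra.
by move/eqP; rewrite mulf_eq0 (gt_eqF t0) /= => /eqP.
Qed.

Lemma tail_NA_supnorm (f : dual (@supnorm R)) k :
  (forall h, (forall n, (n < k)%N -> h n = 0) -> f h = 0 :> R) -> NA (@supnorm R) f.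
Proof.
(* K is positive, so that the sign vector y has norm one also when k = 0. *)
move=> f0; pose K := k.+1.
have basis n : exists e : c0 R, forall i, e i = (i == n)%:R :> R.
  by apply: (@mk_c0 _ n.+1) => i ni; rewrite gtn_eqF.
have [e eE] := choice basis.
have fE z : f z = \sum_(n < K) (z n : R) * (f (e n) : R) :> R.
  pose w := \sum_(n < K) (z n : R) *: e n.
  have -> : \sum_(n < K) (z n : R) * (f (e n) : R) = f w :> R.
    rewrite /w; elim: K {w} => [|K' IH]; first by rewrite !big_ord0 (dual_fun0 f).
    by rewrite !big_ord_recr /= dual_funD dual_funZ IH.
  apply/eqP; rewrite -subr_eq0 -(dual_funN f w) -dual_funD; apply/eqP/f0 => n nk.
  have nK : (n < K)%N by rewrite ltnS ltnW.
  apply/eqP; rewrite -[X in X == _]/((z n : R) - w n) subr_eq0; apply/eqP.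
  rewrite /w c0_sum (eq_bigr (fun i : 'I_K => if i == n :> nat then z n : R else 0)).
    by rewrite sum_ord_delta.
  move=> i _; rewrite c0Z eE eq_sym.
  by have [->|_] := eqVneq (i : nat) n; rewrite ?mulr1 ?mulr0.
have [y yE] : exists y : c0 R, forall n, y n =
    (if (n < K)%N then (if 0 <= (f (e n) : R) then 1 else -1) else 0) :> R.
  by apply: (@mk_c0 _ K) => n; rewrite leqNgt => /negPf ->.
have y1 : supnorm y = 1.
  apply/eqP; rewrite eq_le; apply/andP; split.
    apply: supnorm_le => n; rewrite yE; case: ifP => _; rewrite ?normr0 //.
    by case: ifP; rewrite ?normrN normr1.
  apply: le_trans (le_supnorm y 0); rewrite yE /=.
  by case: ifP; rewrite ?normrN normr1.
have fy : f y = \sum_(n < K) `|(f (e n) : R)| :> R.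
  rewrite fE; apply: eq_bigr => n _; rewrite yE ltn_ord.
  by case: (leP 0 (f (e n) : R)) => h; rewrite ?mul1r ?mulN1r; [rewrite ger0_norm|rewrite ltr0_norm].
exists y => //; apply/eqP; rewrite eq_le; apply/andP; split.
  by apply: le_trans (dual_norm_ub sn f y) _; rewrite y1 mulr1.
rewrite fy ger0_norm ?sumr_ge0 //; apply: dual_norm_le => //; first exact: sumr_ge0.
move=> z; rewrite fE mulr_suml; apply: le_trans (ler_norm_sum _ _ _) _.
by apply: ler_sum => n _; rewrite normrM mulrC ler_wpM2l // le_supnorm.
Qed.

Section EquivNorm.
Variable N : c0 R -> R.
Hypothesis N_norm : is_norm N.
Hypothesis N_equiv : equivalent_norms (@supnorm R) N.
Hypothesis N_NA : [set dual_fun f | f in NA N] = [set dual_fun f | f in NA (@supnorm R)].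

(** [N_NA] compares underlying functions, since functionals for different norms have different
    types; the equivalence of the norms carries f over. In this form the linearity of [NA N] is
    visible. *)
Lemma NA_tailP (f : dual N) : NA N f <->
  exists k, forall h, (forall n, (n < k)%N -> h n = 0) -> f h = 0 :> R.
Proof.
split=> [fNA|[k hk]].
  have : [set dual_fun f | f in NA N] (dual_fun f) by exists f.
  by rewrite N_NA => -[f' f'NA <-]; exact: NA_supnorm_tail.
have [c [D [cpos D0 hN]]] := N_equiv.
have [E hE] := dual_bounded f.
have [|f' f'E] := @mk_dual R (c0 R) (@supnorm R) (dual_fun f) (dual_norm N f * D) (dual_linear f).
  move=> z; apply: le_trans (dual_norm_ub N_norm f z) _.
  by rewrite -mulrA ler_wpM2l ?dual_norm_ge0 // (hN z).2.
have : [set dual_fun f | f in NA (@supnorm R)] (dual_fun f).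
  by exists f' => //; apply: (@tail_NA_supnorm _ k) => h /hk; rewrite f'E.
rewrite -N_NA => -[f'' f''NA e].
by rewrite -(val_inj e : f'' = f).
Qed.

Lemma NA_comb (I : finType) (al : I -> R) (F : I -> dual N) :
  (forall i, NA N (F i)) -> NA N (\sum_i al i *: F i).
Proof.
move=> hF; apply/NA_tailP.
have [k hk] := choice (fun i => (NA_tailP (F i)).1 (hF i)).
exists (\max_i k i) => h h0; rewrite dual_sum big1 // => i _.
rewrite dualZ (hk i) ?mulr0 // => n nk; apply: h0; apply: leq_trans nk _.
exact: leq_bigmax.
Qed.

Lemma coord_dual n : exists f : dual N, forall x, f x = x n :> R.
Proof.
have [c [D [cpos D0 hN]]] := N_equiv.
have [|z|f fE] := @mk_dual R (c0 R) N (fun z => z n) c^-1.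
- by move=> a z w.
- rewrite ler_pdivlMl //; apply: le_trans (hN z).1.
  by rewrite ler_pM2l // le_supnorm.
- by exists f => z; rewrite fE.
Qed.

End EquivNorm.

Lemma c0_nonzero_coord x : x != 0 -> exists k, (x k : R) != 0.
Proof.
move=> x0; apply: contrapT => hn; move/eqP: x0; apply; apply: c0_eq => n.
by apply: contrapT => xn; apply: hn; exists n; apply/eqP.
Qed.

Lemma c0_proportional x y : x != 0 -> y != 0 ->
  (forall i j, (x i : R) * (y j : R) = (x j : R) * (y i : R)) ->
  exists2 c : R, c != 0 & y = c *: x.
Proof.
move=> x0 y0 e.
have [k xk] := c0_nonzero_coord x0.
have yE : y = ((y k : R) / (x k : R)) *: x.
  apply: c0_eq => n; rewrite -[RHS]/((y k : R) / (x k : R) * (x n : R)).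
  apply: (mulfI xk); rewrite e; by field.
exists ((y k : R) / (x k : R)) => //.
by apply: contra_neq y0 => h; rewrite yE h scale0r.
Qed.

End C0.

(** * Sign patterns of the v*_{n,m} *)

Lemma sgr_close (R : realDomainType) (a b d : R) : d <= `|a| -> `|a - b| < d ->
  Num.sg b = Num.sg a /\ d - `|a - b| <= `|b|.
Proof.
move=> da ab; have d0 : 0 < d by exact: le_lt_trans ab.
have [a0|a0] := leP 0 a.
  rewrite (ger0_norm a0) in da; have := ab; rewrite ltr_norml => /andP[h1 h2].
  have a1 : 0 < a by lra.
  have b1 : 0 < b by lra.
  rewrite !gtr0_sg // (gtr0_norm b1); split=> //.
  have := ler_norm (a - b); lra.
rewrite (ltr0_norm a0) in da; have := ab; rewrite ltr_norml => /andP[h1 h2].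
have b1 : b < 0 by lra.
rewrite !ltr0_sg // (ltr0_norm b1); split=> //.
have := ler_norm (- (a - b)); rewrite normrN; lra.
Qed.

Section Density.
Context {R : realType}.
Variables (N : c0 R -> R) (T : {linear l1 R (nat * nat)%type -> dual N}).
Variable Y : set (dual N).
Hypothesis N_norm : is_norm N.
Hypothesis Y_range : operator_range (dual_norm N) Y.
Hypothesis Y_dense : dense_in (dual_norm N) Y [set: dual N].
Hypothesis T_inj : injective T.
Hypothesis T_dense : forall m : nat,
  dense_in (dual_norm N)
    [set (dual_norm N (vstar T n m))^-1 *: vstar T n m | n in [set: nat]]
    (Y `&` nsphere (dual_norm N)).

Local Notation v := (vstar T).

Lemma seq_norm_bound (s : seq (c0 R)) : exists2 B : R, 0 < B & forall x, x \in s -> N x <= B.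
Proof.
elim: s => [|x s [B B0 hB]]; first by exists 1.
exists (Num.max B (N x)); first by rewrite lt_max B0.
by move=> z; rewrite inE => /predU1P[->|/hB zB]; rewrite le_max ?lexx ?orbT // zB.
Qed.

Lemma seq_abs_bound (y : dual N) (s : seq (c0 R)) : (forall x, x \in s -> y x != 0) ->
  exists2 d : R, 0 < d & forall x, x \in s -> d <= `|y x|.
Proof.
elim: s => [|x s IH] hs; first by exists 1.
have [z zs|d d0 hd] := IH; first by apply: hs; rewrite inE zs orbT.
have yx : 0 < `|y x| by rewrite normr_gt0 hs // inE eqxx.
exists (Num.min d `|y x|); first by rewrite lt_min d0.
by move=> z; rewrite inE => /predU1P[->|/hd dz]; rewrite ge_min ?lexx ?orbT // dz.
Qed.

Lemma Y_scale (a : R) y : Y y -> Y (a *: y).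
Proof.
have [E [j [_ _ _ <-]]] := Y_range => -[z _ <-].
by exists (a *: z) => //; rewrite linearZ.
Qed.

Lemma dual_dist_le (f g : dual N) x : `|(f x : R) - (g x : R)| <= dual_norm N (f - g) * N x.
Proof. exact: (dual_norm_ub N_norm (f - g) x). Qed.

(** y is approximated by an element of Y, which is normalised and then approximated by a normalised
    [v n m]; the signs on s survive both steps. The constant c is the same for all m, whereas the
    saturation threshold tends to 0. *)
Lemma sign_approx (y : dual N) (s : seq (c0 R)) : (forall x, x \in s -> y x != 0) ->
  exists2 c : R, 0 < c & forall m, exists n, forall x, x \in s ->
    Num.sg (v n m x : R) = Num.sg (y x : R) /\ c <= `|v n m x| / dual_norm N (v n m).
Proof.
move=> ys; have [B B0 hB] := seq_norm_bound s; have [d d0 hd] := seq_abs_bound ys.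
have approx (f g : dual N) (r : R) : 0 < r -> dual_norm N (f - g) < r / 2 / B ->
    forall x, x \in s -> `|(f x : R) - (g x : R)| <= r / 2.
  move=> r0 fg x xs; apply: le_trans (dual_dist_le f g x) _.
  apply: le_trans (_ : r / 2 / B * B <= _); last by rewrite divfK // gt_eqF.
  by apply: ler_pM; rewrite ?dual_norm_ge0 ?is_norm_ge0 ?hB // ltW.
(* For nonempty s the approximant [y'] is nonzero and can be normalised. *)
have [->|s0] := eqVneq s [::]; first by exists 1 => // m; exists 0%N.
have [y' Yy' hy'] := Y_dense.2 y I (d / 2 / B) (divr_gt0 (divr_gt0 d0 (ltr0n R 2)) B0).
have y's x : x \in s -> Num.sg (y' x : R) = Num.sg (y x : R) /\ d / 2 <= `|(y' x : R)|.
  move=> xs; have h1 := approx _ _ _ d0 hy' x xs.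
  have [|-> h2] := sgr_close (hd x xs) (b := y' x).
    apply: le_lt_trans h1 _; lra.
  by split=> //; lra.
have nu0 : 0 < dual_norm N y'.
  case: s s0 {ys hB hd approx} y's => // x s _ y's.
  apply: dual_norm_gt0 => //; apply/eqP => e.
  have [|_] := y's x; first by rewrite inE eqxx.
  by rewrite e dual0 normr0; lra.
set nu := dual_norm N y' in nu0.
pose y2 : dual N := nu^-1 *: y'.
have y2s x : x \in s -> Num.sg (y2 x : R) = Num.sg (y x : R) /\ d / 2 / nu <= `|(y2 x : R)|.
  move=> xs; have [<- h] := y's x xs; rewrite /y2 dualZ; split.
    by rewrite sgrM (gtr0_sg (_ : 0 < nu^-1)) ?invr_gt0 // mul1r.
  by rewrite normrM gtr0_norm ?invr_gt0 // mulrC ler_pM2l ?invr_gt0.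
have Yy2 : (Y `&` nsphere (dual_norm N)) y2.
  split; first exact: Y_scale.
  rewrite /nsphere /=; apply/eqP; rewrite eq_le; apply/andP; split.
    apply: dual_norm_le => // x; rewrite mul1r /y2 dualZ normrM gtr0_norm ?invr_gt0 //.
    by rewrite ler_pdivrMl // dual_norm_ub.
  rewrite -(ler_pM2l nu0) mulr1; apply: dual_norm_le => //.
    by rewrite mulr_ge0 ?dual_norm_ge0 // ltW.
  move=> x; have := dual_norm_ub N_norm y2 x; rewrite /y2 dualZ normrM gtr0_norm ?invr_gt0 //.
  by rewrite ler_pdivrMl // mulrA.
pose c : R := d / 2 / nu; have c_gt0 : 0 < c by rewrite !divr_gt0.
exists (c / 2) => [|m]; first by rewrite divr_gt0.
have [w [n _ <-] hw] := (T_dense m).2 y2 Yy2 (c / 2 / B) (divr_gt0 (divr_gt0 c_gt0 (ltr0n R 2)) B0).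
exists n => x xs; have [<- h1] := y2s x xs.
have h2 := approx _ _ _ c_gt0 hw x xs.
have dn := vstar_norm_gt0 N_norm T_inj n m.
have [|h3 h4] := sgr_close h1 (b := ((dual_norm N (v n m))^-1 *: v n m) x).
  apply: le_lt_trans h2 _; rewrite -/c; lra.
rewrite dualZ in h2 h3 h4; split.
  by rewrite -h3 sgrM (gtr0_sg (_ : 0 < (dual_norm N (v n m))^-1)) ?invr_gt0 // mul1r.
have e : `|(dual_norm N (v n m))^-1 * (v n m x : R)| = `|v n m x| / dual_norm N (v n m).
  by rewrite normrM gtr0_norm ?invr_gt0 // mulrC.
by rewrite -e; apply: le_trans h4; rewrite -/c; lra.
Qed.

End Density.

(** A functional vanishing on M is determined by its values at two vectors spanning a complement.
    The 3 by 2 matrix of these values has a nonzero left kernel vector, whose entries are the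
    coefficients. *)
Lemma dual_kernel (R : realType) (V : lmodType R) (N : V -> R) (M : set V) (F : 'I_3 -> dual N) :
    codimension M 2 -> (forall i h, M h -> F i h = 0 :> R) ->
  exists al : 'I_3 -> R, (exists i, al i != 0) /\ \sum_i al i *: F i = 0.
Proof.
move=> [e he] FM; pose A : 'M[R]_(3, 2) := \matrix_(i, j) (F i (e j) : R).
have : ~~ row_free A.
  by rewrite -row_leq_rank -ltnNge (leq_ltn_trans (rank_leq_col A)).
rewrite -kermx_eq0 => /rowV0Pn [u /sub_kermxP uA u0].
exists (fun i => u 0 i); split.
  apply: contrapT => hn; move/eqP: u0; apply; apply/rowP => i; rewrite mxE.
  by apply: contrapT => ui; apply: hn; exists i; apply/eqP.
apply: dual_eq => x; rewrite dual0 dual_sum.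
have [a [ha _]] := he x.
have xE i : F i x = \sum_j a j * (F i (e j) : R) :> R.
  have lin (s : seq 'I_2) : F i (\sum_(j <- s) a j *: e j) = \sum_(j <- s) a j * (F i (e j) : R) :> R.
    by elim: s => [|j s IH]; rewrite ?big_nil ?dual_fun0 // !big_cons dual_funD dual_funZ IH.
  by rewrite -lin; apply/eqP; rewrite -subr_eq0 -(dual_funN (F i)) -dual_funD FM.
under eq_bigr do rewrite dualZ xE mulr_sumr.
rewrite exchange_big big1 //= => j _.
have := congr1 (fun B : 'rV[R]_2 => B 0 j) uA; rewrite !mxE => h.
transitivity (a j * \sum_i u 0 i * A i j); last by rewrite h mulr0.
by rewrite mulr_sumr; apply: eq_bigr => i _; rewrite mxE; ring.
Qed.

(** * From dependent gradients to dependent signs *)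

Section Main.
Context {R : realType}.
Variable N : c0 R -> R.
Hypothesis N_norm : is_norm N.
Hypothesis N_equiv : equivalent_norms (@supnorm R) N.
Hypothesis N_smooth : smooth_norm N.
Hypothesis N_NA : [set dual_fun f | f in NA N] = [set dual_fun f | f in NA (@supnorm R)].
Variable Y : set (dual N).
Hypothesis Y_range : operator_range (dual_norm N) Y.
Hypothesis Y_dense : dense_in (dual_norm N) Y [set: dual N].
Hypothesis Y_NA : NA N `&` Y = [set 0].
Variable T : {linear l1 R (nat * nat)%type -> dual N}.
Hypothesis T_Y : forall a, Y (T a).
Hypothesis T_inj : injective T.
Hypothesis T_dense : forall m : nat,
  dense_in (dual_norm N)
    [set (dual_norm N (vstar T n m))^-1 *: vstar T n m | n in [set: nat]]
    (Y `&` nsphere (dual_norm N)).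
Variable C : R.
Hypothesis C_gt0 : 0 < C.
Hypothesis T_bd : forall a, dual_norm N (T a) <= C * l1norm a.

Local Notation v := (vstar T).
Local Notation hp := (@half_pow R).
Local Notation wt := (@weight R).

(** Guarantees that no [R_op T m x] vanishes, so that each gauge norm has a gradient there. A
    coordinate that is nonzero at x is fed to [sign_approx]. *)
Lemma vstar_separates (x : c0 R) : x != 0 -> forall m, exists n, v n m x != 0.
Proof.
move=> x0 m; have [k xk] := c0_nonzero_coord x0; have [y yE] := coord_dual N_equiv k.
have [z|c c_gt0 /(_ m) [n hn]] :=
    @sign_approx _ N T Y N_norm Y_range Y_dense T_inj T_dense y [:: x].
  by rewrite inE => /eqP ->; rewrite yE.
exists n; have [|_ h] := hn x; first by rewrite inE.
by apply: contraTneq h => ->; rewrite normr0 mul0r -ltNge.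
Qed.

(** In use, f is the gradient of N, g collects those of the gauge norms, and [f + T a] is the
    gradient of p. Its differentiability is recorded by the last clause, through the consequence at
    minima along lines. *)
Definition is_gradient (x : c0 R) (f : dual N) (g : nat -> nat -> R)
    (a : l1 R (nat * nat)%type) : Prop :=
  [/\ NA N f,
      forall n m, a (n, m) = wt m * hp n.+1 * g m n :> R,
      forall m n, C * N x * hp m.+1 < `|v n m x| / dual_norm N (v n m) ->
        exists2 G : R, 1 - C * hp m.+1 <= G <= 1 & g m n = Num.sg (v n m x : R) * G
    & forall h, (forall t : R, p_norm T x <= p_norm T (x + t *: h)) -> (f + T a) h = 0 :> R].

Lemma exists_p_gradient (x : c0 R) : x != 0 -> exists f g a, is_gradient x f g a.
Proof.
move=> x0; have [f hf] := N_smooth x0.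
have [g [a [aE gsat hup]]] := p_upper_derivative N_norm T_inj C_gt0 T_bd (vstar_separates x0).
exists f, g, a; split=> //; first exact: gateaux_NA hf.
move=> h hmin; rewrite dualD.
(* The steps d and -d bound the derivative from both sides; the factor 2 collects the errors from N
   and from the series. *)
have bd (e : R) : 0 < e -> `|(f h : R) + (T a h : R)| <= 2 * e.
  move=> e0; have [d1 d1_gt0 h1] := gateaux_upper hf h e0; have [d2 d2_gt0 h2] := hup h e e0.
  pose d := Num.min d1 d2; have d0 : 0 < d by rewrite lt_min d1_gt0.
  have key (t : R) : `|t| = d -> 0 <= t * ((f h : R) + (T a h : R)) + 2 * e * d.
    move=> td; have t1 : `|t| <= d1 by rewrite td ge_min lexx.
    have t2 : `|t| <= d2 by rewrite td ge_min lexx orbT.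
    have := hmin t; rewrite !p_normE; have := h1 t t1; have := h2 t t2; rewrite td.
    lra.
  have k1 := key d (gtr0_norm d0).
  have k2 : 0 <= - d * ((f h : R) + (T a h : R)) + 2 * e * d.
    by apply: key; rewrite normrN gtr0_norm.
  by rewrite ler_norml; apply/andP; split; rewrite -(ler_pM2l d0); lra.
apply/eqP; rewrite -normr_le0; apply/ler_addgt0Pr => e e0.
by have := bd (e / 2) (divr_gt0 e0 (ltr0n R 2)); rewrite add0r mulrC divfK.
Qed.

Lemma sign_perturb (y w : dual N) (s : seq (c0 R)) : (forall z, z \in s -> y z != 0) ->
  exists2 e : R, 0 < e & forall t : R, `|t| <= e -> forall z, z \in s ->
    Num.sg ((y + t *: w) z : R) = Num.sg (y z : R).
Proof.
move=> ys; have [d d0 hd] := seq_abs_bound ys; have [B B0 hB] := seq_norm_bound N s.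
pose K : R := dual_norm N w * B + 1.
have K0 : 0 < K by rewrite ltr_wpDl // mulr_ge0 ?dual_norm_ge0 // ltW.
exists (d / 2 / K); first by rewrite !divr_gt0.
move=> t ht z zs; apply: (sgr_close (hd z zs) _).1.
rewrite dualD dualZ opprD addrA subrr add0r normrN normrM.
have wz : `|(w z : R)| <= K.
  apply: le_trans (dual_norm_ub N_norm w z) _; apply: le_trans (_ : dual_norm N w * B <= _).
    by rewrite ler_wpM2l ?dual_norm_ge0 // hB.
  by rewrite lerDl.
apply: (@le_lt_trans _ _ (d / 2 / K * K)); first by apply: ler_pM.
by rewrite divfK ?gt_eqF //; lra.
Qed.

Section Family.
Variables (I : finType) (x : I -> c0 R).
Hypothesis x_neq0 : forall i, x i != 0.
Hypothesis x_indep : forall i j, i != j ->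
  exists k l, (x i k : R) * (x j l : R) != (x i l : R) * (x j k : R).
Variables (f : I -> dual N) (g : I -> nat -> nat -> R) (a : I -> l1 R (nat * nat)%type).
Hypothesis grad : forall i, is_gradient (x i) (f i) (g i) (a i).
Variable al : I -> R.
Hypothesis al_dep : \sum_i al i *: (f i + T (a i)) = 0.

(** The relation splits because [NA N] is linear and meets Y only in 0; injectivity of T and the
    positive weights then make it hold at each pair of indices. *)
Lemma gradient_dep m n : \sum_i al i * g i m n = 0.
Proof.
have e : \sum_i al i *: f i = - T (\sum_i al i *: a i).
  apply/eqP; rewrite -addr_eq0 linear_sum -big_split /= -[X in _ == X]al_dep.
  by apply/eqP; apply: eq_bigr => i _; rewrite linearZ scalerDr.
have : (NA N `&` Y) (\sum_i al i *: f i).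
  split; first by apply: (NA_comb N_norm N_equiv N_NA) => i; case: (grad i).
  by rewrite e -linearN; exact: T_Y.
rewrite Y_NA /= e => /eqP; rewrite oppr_eq0 => /eqP T0.
have a0 : \sum_i al i *: a i = 0 by apply: T_inj; rewrite T0 raddf0.
have := congr1 (fun b : l1 R (nat * nat)%type => b (n, m) : R) a0.
rewrite /= l1_sum.
have -> : \sum_i ((al i *: a i) (n, m) : R) = wt m * hp n.+1 * \sum_i al i * g i m n.
  rewrite mulr_sumr; apply: eq_bigr => i _; case: (grad i) => _ aE _ _.
  by rewrite -[LHS]/(al i * (a i (n, m) : R)) aE; ring.
move/eqP; rewrite mulf_eq0 gt_eqF /=; first by move/eqP.
by rewrite mulr_gt0 ?half_pow_gt0 // divr_gt0 // exprn_gt0.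
Qed.

Lemma sign_dep (y : dual N) : (forall i, y (x i) != 0) ->
  \sum_i al i * Num.sg (y (x i) : R) = 0.
Proof.
move=> yx.
have [z|c c_gt0 happrox] :=
    @sign_approx _ N T Y N_norm Y_range Y_dense T_inj T_dense y [seq x i | i <- enum I].
  by move=> /mapP[i _ ->].
pose S : R := \sum_i `|al i|; have S0 : 0 <= S by apply: sumr_ge0.
have [B B0 hB] := seq_norm_bound N [seq x i | i <- enum I].
have mem i : x i \in [seq x i | i <- enum I] by apply: map_f; rewrite mem_enum.
apply/eqP; rewrite -normr_le0; apply/ler_addgt0Pr => e e0; rewrite add0r.
have SC0 : 0 <= S * C by rewrite mulr_ge0 // ltW.
have CB0 : 0 < C * B by rewrite mulr_gt0.
(* m is so large that c exceeds the saturation threshold at every point of the family, bounded by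
   [C * B * half_pow m.+1], and that the total error [S * C * half_pow m.+1] is below e. *)
have [k1 hk1] := half_pow_lt (divr_gt0 c_gt0 CB0).
have [k2 hk2] := half_pow_lt (divr_gt0 e0 (ltr_wpDl SC0 (ltr01 : 0 < 1 :> R))).
pose m := maxn k1 k2.
have m1 : hp m.+1 < c / (C * B) by apply: hk1; rewrite leqW // leq_maxl.
have m2 : hp m.+1 < e / (S * C + 1) by apply: hk2; rewrite leqW // leq_maxr.
have hm := half_pow_gt0 R m.+1.
have [n hn] := happrox m.
have gE i : exists2 G : R, 1 - C * hp m.+1 <= G <= 1 & g i m n = Num.sg (y (x i) : R) * G.
  case: (grad i) => _ _ gsat _; have [sgE cle] := hn (x i) (mem i).
  have [|G G1 ->] := gsat m n; last by exists G; rewrite ?sgE.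
  apply: lt_le_trans cle; rewrite ltr_pdivlMr // in m1; apply: le_lt_trans m1.
  rewrite mulrC ler_pM2l //; apply: ler_wpM2l; [exact: ltW|exact: hB].
have dep := gradient_dep m n.
have -> : \sum_i al i * Num.sg (y (x i) : R) = \sum_i al i * (Num.sg (y (x i) : R) - g i m n).
  by under [RHS]eq_bigr do rewrite mulrBr; rewrite sumrB dep subr0.
apply: le_trans (ler_norm_sum _ _ _) _.
apply: (@le_trans _ _ (\sum_i `|al i| * (C * hp m.+1))).
  apply: ler_sum => i _; rewrite normrM ler_wpM2l //.
  have [G /andP[G1 G2] ->] := gE i.
  have -> : Num.sg (y (x i) : R) - Num.sg (y (x i) : R) * G = Num.sg (y (x i) : R) * (1 - G) by ring.
  rewrite normrM normr_sg yx mul1r ger0_norm; lra.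
rewrite -mulr_suml -/S mulrA; rewrite ltr_pdivlMr in m2; last by rewrite ltr_wpDl.
have : 0 <= hp m.+1 * 1 by lra.
lra.
Qed.

(** Induction over the other indices: if y vanishes at the next point, a small multiple of a
    functional that vanishes at [x i0] but not at that point is added. Smallness preserves the
    nonzero values already obtained. *)
Lemma exists_vanishing i0 : exists y : dual N,
  y (x i0) = 0 :> R /\ forall i, i != i0 -> y (x i) != 0.
Proof.
suff H (s : seq I) : i0 \notin s -> exists y : dual N, y (x i0) = 0 :> R /\
    forall z, z \in [seq x i | i <- s] -> y z != 0.
  have [|y [y0 hy]] := H [seq j <- enum I | j != i0]; first by rewrite mem_filter /= eqxx.
  by exists y; split=> // i ii; apply: hy; apply: map_f; rewrite mem_filter mem_enum /= ii.
elim: s => [|i s IH]; first by exists 0.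
rewrite inE negb_or => /andP[i0i i0s]; have [y [y0 hy]] := IH i0s.
have [yi|yi] := eqVneq (y (x i) : R) 0; last first.
  by exists y; split=> // z; rewrite inE => /predU1P[-> //|]; exact: hy.
have [k [l kl]] := x_indep i0i.
have [ck ckE] := coord_dual N_equiv k; have [cl clE] := coord_dual N_equiv l.
(* A two by two minor: it vanishes at [x i0], and k and l are such that it does not vanish at
   [x i]. *)
pose w : dual N := (x i0 k : R) *: cl - (x i0 l : R) *: ck.
have wE z : w z = (x i0 k : R) * (z l : R) - (x i0 l : R) * (z k : R) :> R.
  by rewrite /w dualD dualN !dualZ ckE clE.
have [e e0 he] := sign_perturb w hy.
exists (y + e *: w); split.
  by rewrite dualD dualZ y0 wE; ring.
move=> z; rewrite inE => /predU1P[->|zs].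
  rewrite dualD dualZ yi add0r; apply: mulf_neq0; first by rewrite gt_eqF.
  by rewrite wE subr_eq0.
have := he e; rewrite gtr0_norm // lexx => /(_ isT z zs) sgE.
by have := hy z zs; rewrite -sgr_eq0 -[in X in _ -> X]sgr_eq0 sgE.
Qed.

(** Adding to y plus or minus a small multiple of a coordinate that is nonzero at [x i0] changes the
    sign at [x i0] only; the difference of the two sign relations isolates [al i0]. *)
Lemma al_eq0 i0 : al i0 = 0.
Proof.
have [y [y0 hy]] := exists_vanishing i0.
have [k xk] := c0_nonzero_coord (x_neq0 i0); have [w wE] := coord_dual N_equiv k.
have [z|e e0 he] := @sign_perturb y w [seq x i | i <- [seq j <- enum I | j != i0]].
  by move=> /mapP[i]; rewrite mem_filter => /andP[/= /hy ? _] ->.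
have he' (t : R) i : `|t| = e -> i != i0 ->
    Num.sg ((y + t *: w) (x i) : R) = Num.sg (y (x i) : R).
  move=> te ii; apply: he; first by rewrite te.
  by apply: map_f; rewrite mem_filter mem_enum /= ii.
have at0 (t : R) : (y + t *: w) (x i0) = t * (x i0 k : R) :> R.
  by rewrite dualD dualZ y0 add0r wE.
have dep (t : R) : `|t| = e -> al i0 * Num.sg (t * (x i0 k : R)) +
    \sum_(i | i != i0) al i * Num.sg (y (x i) : R) = 0.
  move=> te; have t0 : t != 0 by rewrite -normr_gt0 te.
  have nz i : (y + t *: w) (x i) != 0.
    have [->|ii] := eqVneq i i0; first by rewrite at0 mulf_neq0.
    by have := hy i ii; rewrite -sgr_eq0 -(he' t i te ii) sgr_eq0.
  rewrite -[RHS](sign_dep nz) [in RHS](bigD1 i0 (erefl true)) -at0; congr (_ + _).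
  by apply: eq_bigr => i ii; rewrite he'.
have d1 := dep e (gtr0_norm e0); have d2 := dep (- e).
rewrite normrN gtr0_norm // in d2; have {}d2 := d2 erefl.
rewrite mulNr sgrN mulrN in d2; rewrite sgrM (gtr0_sg e0) mul1r in d1 d2.
have : al i0 * Num.sg (x i0 k : R) = 0 by lra.
by move/eqP; rewrite mulf_eq0 sgr_eq0 (negPf xk) orbF => /eqP.
Qed.

End Family.

End Main.

(** * Quotients *)

Section Cosets.
Context {R : realType} {V : lmodType R}.
Variables (p : V -> R) (M : set V).
Hypothesis p_ge0 : forall x, 0 <= p x.
Hypothesis pZ : forall (a : R) x, p (a *: x) = `|a| * p x.
Hypothesis p_eq0 : forall x, p x = 0 -> x = 0.
Hypothesis M_subspace : linear_subspace M.

(** The norm-one points of least norm in their coset: the set A of the outline, in a form that also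
    suits metric projections. *)
Definition normed_minimal : set V := [set x | p x = 1 /\ forall m, M m -> 1 <= p (x + m)].

Lemma subspaceZ (a : R) m : M m -> M (a *: m).
Proof. by move=> Mm; have := M_subspace.2 a m 0 Mm M_subspace.1; rewrite addr0. Qed.

Lemma subspaceD m n : M m -> M n -> M (m + n).
Proof. by move=> Mm Mn; have := M_subspace.2 1 m n Mm Mn; rewrite scale1r. Qed.

Lemma coset_addr x m : M m -> coset M (x + m) = coset M x.
Proof.
move=> Mm; apply/seteqP; split=> _ [n Mn <-].
  by exists (m + n); [exact: subspaceD|rewrite addrA].
exists (- m + n); last by rewrite addrA addrK.
by apply: subspaceD => //; rewrite -scaleN1r; exact: subspaceZ.
Qed.

Lemma nball_quotient_sphere x :
  nball p x -> quotient_sphere p M (coset M x) -> normed_minimal x.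
Proof.
rewrite /nball /= => px [_ q1].
have low m : M m -> 1 <= p (x + m).
  move=> Mm; rewrite -q1; apply: ge_inf; first by exists 0 => _ [y _ <-].
  by exists (x + m) => //; exists m.
split=> //; apply/eqP; rewrite eq_le px /=.
by have := low 0 M_subspace.1; rewrite addr0.
Qed.

(** The error x - m, once normalised, has least norm in its coset; so claim (c) is about the same
    points as (a) and (b). *)
Lemma best_approximation_minimal x : ~ M x -> metric_projection p M x !=set0 ->
  exists (d : R) z, normed_minimal z /\ coset M x = coset M (d *: z).
Proof.
move=> Mx [m [Mm pm]].
have d0 : 0 < p (x - m).
  rewrite lt_neqAle p_ge0 andbT; apply/eqP => e; apply: Mx.
  by have /eqP := p_eq0 (esym e); rewrite subr_eq0 => /eqP ->.
have low n : M n -> p (x - m) <= p (x - n).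
  by move=> Mn; rewrite pm; apply: ge_inf; [exists 0 => _ [y _ <-]|exists n].
exists (p (x - m)), ((p (x - m))^-1 *: (x - m)); split; last first.
  rewrite scalerA divff ?gt_eqF // scale1r coset_addr //.
  by rewrite -scaleN1r; exact: subspaceZ.
split; first by rewrite pZ normfV gtr0_norm // mulVf ?gt_eqF.
move=> n Mn; set d := p (x - m) in d0 low *.
have -> : d^-1 *: (x - m) + n = d^-1 *: (x - (m - d *: n)).
  by rewrite opprB addrA (addrAC x) [RHS]scalerDr scalerA mulVf ?gt_eqF // scale1r.
rewrite pZ normfV gtr0_norm // ler_pdivlMl // mulr1; apply: low.
by apply: subspaceD => //; rewrite -scaleN1r; apply: subspaceZ; apply: subspaceZ.
Qed.

End Cosets.

(** * Minimal points up to sign, and the three claims *)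

Theorem proposition6 (R : realType)
    (* the norm |||.||| on c_0 *)
    (N : c0 R -> R)
    (N_norm : is_norm N)
    (N_equiv : equivalent_norms (@supnorm R) N)
    (N_smooth : smooth_norm N)
    (N_NA : [set dual_fun f | f in NA N] = [set dual_fun f | f in NA (@supnorm R)])
    (* the operator range Y *)
    (Y : set (dual N))
    (Y_range : operator_range (dual_norm N) Y)
    (Y_sep : separable (dual_norm N) Y)
    (Y_dense : dense_in (dual_norm N) Y [set: dual N])
    (Y_NA : NA N `&` Y = [set 0])
    (* the operator T : l_1(N x N) -> Y *)
    (T : {linear l1 R (nat * nat)%type -> dual N})
    (T_Y : forall a, Y (T a))
    (T_bounded : is_bounded (@l1norm R (nat * nat)%type) (dual_norm N) T)
    (T_norm : opnorm (@l1norm R (nat * nat)%type) (dual_norm N) T = 1)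
    (T_inj : injective T)
    (T_dense : forall m : nat,
       dense_in (dual_norm N)
         [set (dual_norm N (vstar T n m))^-1 *: vstar T n m | n in [set: nat]]
         (Y `&` nsphere (dual_norm N)))
    (* the closed subspace M of codimension two *)
    (M : set (c0 R))
    (M_subspace : linear_subspace M)
    (M_closed : nclosed (p_norm T) M)
    (M_codim : codimension M 2) :
  let p := p_norm T in
  [/\ (* (a) *)
      exists x1 x2 : c0 R,
        nball p `&` [set x | quotient_sphere p M (coset M x)]
          `<=` [set x1; x2; - x1; - x2],
      (* (b) *)
      exists x1 x2 : c0 R,
        [/\ nball p x1, nball p x2, x1 <> x2
          & [set coset M x | x in nball p] `&` quotient_sphere p M
              `<=` [set coset M x1; coset M x2; coset M (- x1); coset M (- x2)]]
    & (* (c) *)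
      exists x1 x2 : c0 R,
        x1 <> x2 /\
        [set coset M x | x in [set x | ~ M x /\ metric_projection p M x !=set0]]
          `<=` quotient_line M x1 `|` quotient_line M x2].
Proof.
move=> p.
have [C0 hC0] := T_bounded.
(* The maximum with 1 makes the bound on T positive. *)
pose C : R := Num.max C0 1.
have C_gt0 : 0 < C by rewrite lt_max ltr01 orbT.
have T_bd a : dual_norm N (T a) <= C * l1norm a.
  apply: le_trans (hC0 a) _; rewrite ler_wpM2r ?l1norm_ge0 //.
  by rewrite le_max lexx.
have p_ge0 x : 0 <= p x by exact: (p_norm_ge0 N_norm C_gt0 T_bd).
have pZ (a : R) x : p (a *: x) = `|a| * p x by exact: (p_normZ N_norm C_gt0 T_bd).
have p_eq0 x : p x = 0 -> x = 0 by apply: (p_norm_eq0 N_norm C_gt0 T_bd).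
have pN x : p (- x) = p x by rewrite -scaleN1r pZ normrN1 mul1r.
pose A := normed_minimal p M.
have A_neq0 x : A x -> x != 0.
  move=> [px _]; apply/eqP => x0; move: px; rewrite x0 -(scale0r 0) pZ normr0 mul0r.
  by move/eqP; rewrite eq_sym oner_eq0.
have A_prop x y : A x -> A y ->
    (forall k l, (x k : R) * (y l : R) = (x l : R) * (y k : R)) -> y = x \/ y = - x.
  move=> Ax Ay e; have [c c0 yE] := c0_proportional (A_neq0 x Ax) (A_neq0 y Ay) e.
  have : `|c| = 1 by have := Ay.1; rewrite yE pZ Ax.1 mulr1.
  move/eqP; rewrite eqr_norml ler01 andbT yE => /orP[] /eqP ->; [left|right].
    by rewrite scale1r.
  by rewrite scaleN1r.
have A_three (x : 'I_3 -> c0 R) : (forall i, A (x i)) ->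
    exists i j, i != j /\ (x j = x i \/ x j = - x i).
  (* If no two of the points agree up to sign, they are pairwise not proportional by [A_prop], and
     [al_eq0] kills the coefficients that [dual_kernel] provides, not all zero. *)
  move=> Ax; apply: contrapT => hn.
  have x0 i : x i != 0 by exact: A_neq0.
  (* The three witnesses are packed into a triple, so that a single use of [choice] covers them. *)
  have [fga hfga] := choice (fun i : 'I_3 =>
    let: ex_intro f (ex_intro g (ex_intro a h)) :=
      exists_p_gradient N_norm N_equiv N_smooth Y_range Y_dense T_inj T_dense C_gt0 T_bd (x0 i) in
    ex_intro (fun q => is_gradient T C (x i) q.1.1 q.1.2 q.2) (f, g, a) h).
  have [|al [[i ali] dep]] := @dual_kernel R _ N M (fun i => (fga i).1.1 + T (fga i).2) M_codim.
    (* A point of least norm in its coset minimises p along every line in a direction of M, so the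
       gradient vanishes on M. *)
    move=> i h Mh; case: (hfga i) => _ _ _; apply => t.
    by rewrite -/p (Ax i).1; apply: (Ax i).2; exact: subspaceZ.
  move/eqP: ali; apply.
  apply: (al_eq0 N_norm N_equiv N_NA Y_range Y_dense Y_NA T_Y T_inj T_dense C_gt0 x0 _ hfga dep).
  move=> j k jk; apply: contrapT => hkl; apply: hn; exists j, k; split=> //.
  apply: A_prop => // r s; apply: contrapT => h; apply: hkl; exists r, s; exact/eqP.
(* The two points must be distinct even if A has fewer than two points up to sign; 0, and a unit
   vector e when A is empty, fill the vacant places. *)
have A_pair : exists x1 x2, [/\ nball p x1, nball p x2, x1 <> x2 &
    A `<=` [set x1; x2; - x1; - x2]].
  have [e e1] : exists e : c0 R, p e = 1.
    have [u uE] := @mk_c0 R (fun n => (n == 0%N)%:R) 1 (fun n => ltac:(by case: n)).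
    have u0 : u != 0.
      by apply/eqP => u0; have /eqP := uE 0%N; rewrite u0 eqxx eq_sym oner_eq0.
    have pu : 0 < p u by rewrite lt_neqAle p_ge0 andbT; apply: contra_neq u0 => /esym/p_eq0.
    by exists ((p u)^-1 *: u); rewrite pZ normfV gtr0_norm // mulVf ?gt_eqF.
  have e_neq0 : e <> 0.
    by move=> e0; move: e1; rewrite e0 -(scale0r 0) pZ normr0 mul0r => /eqP; rewrite eq_sym oner_eq0.
  have b0 : nball p 0 by rewrite /nball /= -(scale0r 0) pZ normr0 mul0r.
  have bA x : A x -> nball p x by move=> [px _]; rewrite /nball /= px.
  have [[x1 Ax1]|A0] := pselect (exists x, A x); last first.
    exists 0, e; split=> //; [by rewrite /nball /= e1|by move/esym|].
    by move=> x Ax; case: A0; exists x.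
  have [[x2 [Ax2 x12]]|hA] := pselect (exists x, A x /\ ~ (x = x1 \/ x = - x1)); last first.
    exists x1, 0; split=> //; [exact: bA|by apply/eqP; exact: A_neq0|].
    move=> x Ax; have [xx|xx] := pselect (x = x1 \/ x = - x1).
      by case: xx => ->; [left; left; left|left; right].
    by case: hA; exists x.
  exists x1, x2; split; [exact: bA|exact: bA|by move=> e12; apply: x12; left|].
  move=> x Ax /=.
  (* Among x1, x2 and x, the pair x1, x2 is ruled out by the choice of x2, so x agrees up to sign
     with x1 or x2. *)
  have [|i [j [ij hij]]] := A_three (fun i : 'I_3 => nth x1 [:: x1; x2; x] i).
    by case=> [[|[|[|//]]] ?].
  have two (y z : c0 R) : y = z \/ y = - z -> z = y \/ z = - y.
    by case=> ->; [left|right; rewrite opprK].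
  have : (x = x1 \/ x = - x1) \/ (x = x2 \/ x = - x2).
    case: i j ij hij => [[|[|[|//]]] ?] [[|[|[|//]]] ?]; rewrite -val_eqE //= => _ hij.
    - by left.
    - by case: x12; apply: two.
    - by right.
    - by left; apply: two.
    - by right; apply: two.
  by case=> -[] ->; [left; left; left|left; right|left; left; right|right].
have [x1 [x2 [b1 b2 x12 hA]]] := A_pair.
split.
- exists x1, x2 => x [bx qx]; apply: hA; exact: (nball_quotient_sphere p_ge0 M_subspace bx qx).
- exists x1, x2; split=> // _ [[x bx <-] qx].
  have /hA := nball_quotient_sphere p_ge0 M_subspace bx qx.
  by case=> [[[]|]|] ->; [left; left; left|left; left; right|left; right|right].
- exists x1, x2; split=> // _ [x [Mx Px] <-].
  have [d [z [/hA hz ->]]] := best_approximation_minimal p_ge0 pZ p_eq0 M_subspace Mx Px.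
  (* For [- x1] and [- x2] the sign is moved into the coefficient of the line. *)
  case: hz => [[[]|]|] ->; [left; exists d|right; exists d|left; exists (- d)|right; exists (- d)] => //.
  + by rewrite scalerN scaleNr.
  + by rewrite scalerN scaleNr.
Qed.
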